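(* Let $\alpha,\beta>0$ and $0<a<1$. The characteristic function and the (generalized) density of the $a$-remainder of the symmetric bilateral gamma law $\mathfrak{b}\Gamma(\alpha,\beta)$ are $$\chi_a(u)=\sum_{k=0}^\infty\binom{\alpha+k-1}{k}a^{2\alpha}\left(1-a^2\right)^k\left(\frac{\beta^2}{\beta^2+a^2u^2}\right)^k,$$ $$g_a(x,\alpha,\beta)=a^{2\alpha}\delta(x)+\sum_{k=1}^\infty\binom{\alpha+k-1}{k}a^{2\alpha}\left(1-a^2\right)^k\bar f_{k,\beta/a}(x),$$ where, for $n\ge1$, $b>0$ and $x\neq0$, $$\bar f_{n,b}(x)=\frac{b}{2^n(n-1)!}\left(b|x|\right)^{n-1}e^{-b|x|}\sum_{j=0}^{n-1}\frac{(n-1+j)!}{j!\,(n-1-j)!\,(2b)^j|x|^j}.$$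
   Context: The symmetric bilateral gamma law $\mathfrak{b}\Gamma(\alpha,\beta)$ is the law of $X^{(u)}-X^{(d)}$ with $X^{(u)},X^{(d)}$ independent gamma random variables with shape $\alpha$ and rate $\beta$; its characteristic function is $\varphi(u)=\left(\frac{\beta^2}{\beta^2+u^2}\right)^{\alpha}$. It is self-decomposable: for every $0<a<1$ there is a probability law, called the law of the $a$-remainder, with characteristic function $\chi_a$ such that $\varphi(u)=\varphi(au)\chi_a(u)$. $\binom{\alpha+k-1}{k}=\frac{\alpha(\alpha+1)\cdots(\alpha+k-1)}{k!}$ (equal to $1$ for $k=0$). $\delta$ is the Dirac delta at $0$, so a density containing a term $c\,\delta(x)$ denotes a law with an atom of mass $c$ at $0$. *)

(* Defs.v *)
From HB Require Import structures.
From mathcomp Require Import all_boot all_order all_algebra.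
From mathcomp Require Import all_classical all_reals all_analysis.
From mathcomp Require Import complex.

Set Implicit Arguments.
Unset Strict Implicit.
Unset Printing Implicit Defensive.

Import Order.TTheory GRing.Theory Num.Theory.
Import numFieldNormedType.Exports.

Local Open Scope classical_set_scope.
Local Open Scope ring_scope.

Section BilateralGamma.
Context {R : realType}.
Local Notation leb := (@lebesgue_measure R).
Implicit Types (alpha beta a b c u x y : R).

Definition euler_gamma alpha : R :=
  fine (\int[leb]_(x in `]0%R, +oo[) ((x `^ (alpha - 1)) * expR (- x))%:E)%E.

(* [beta] is the rate, not the scale *)
Definition gamma_pdf alpha beta : R -> R :=
  (fun x => beta `^ alpha / euler_gamma alpha
            * x `^ (alpha - 1) * expR (- (beta * x))) \_ `]0, +oo[.

(* As for the library's [exponential_prob], the laws below are bare set functions;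
   they are probabilities only when the parameters are positive. *)
Definition gamma_law alpha beta : set (measurableTypeR R) -> \bar R :=
  fun A => (\int[leb]_(x in A) (gamma_pdf alpha beta x)%:E)%E.

(* The product measure is the joint law of two independent gamma variables. *)
Definition bilateral_gamma_law alpha beta :
    set (measurableTypeR R) -> \bar R :=
  pushforward (gamma_law alpha beta \x gamma_law alpha beta)%E
    (fun z : measurableTypeR R * measurableTypeR R =>
       (z.1 - z.2 : measurableTypeR R)).

(* u |-> E[exp(iuX)] for X of law mu *)
Definition charfun (mu : set (measurableTypeR R) -> \bar R) u : R[i] :=
  (fine (\int[mu]_x (cos (u * x))%:E)%E
   +i* fine (\int[mu]_x (sin (u * x))%:E)%E)%C.

Definition is_remainder a (mu : set (measurableTypeR R) -> \bar R)
    (P : probability (measurableTypeR R) R) : Prop :=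
  forall u, charfun mu u = charfun mu (a * u) * charfun P u.

(* binomial coefficient (alpha + k - 1 choose k) with a real upper argument *)
Definition rising_binomial alpha (k : nat) : R :=
  (\prod_(i < k) (alpha + i%:R)) / k`!%:R.

(* Only meant for 0 < n and x != 0. *)
Definition fbar (n : nat) b x : R :=
  b / (2 ^+ n * (n.-1)`!%:R) * (b * `|x|) ^+ n.-1 * expR (- (b * `|x|)) *
  \sum_(j < n) ((n.-1 + j)`!%:R /
     ((j`! * (n.-1 - j)`!)%:R * (2 * b) ^+ j * `|x| ^+ j)).

(* P is the law with the generalized density c * delta_0 + g. *)
Definition has_generalized_density (P : probability (measurableTypeR R) R)
    c (g : R -> R) : Prop :=
  [/\ 0 <= c,
      measurable_fun [set: measurableTypeR R] (g : measurableTypeR R -> R),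
      forall x, 0 <= g x
    & forall A : set (measurableTypeR R), measurable A ->
        P A = (c%:E * \d_(0%R : measurableTypeR R) A
               + \int[leb]_(x in A) (g x)%:E)%E].

End BilateralGamma.

(* Main.v *)
(** Let q = beta^2 / (beta^2 + a^2 u^2). The modulus squared of the Fourier integral of
    the gamma kernel satisfies a first-order ODE in u, so the bilateral gamma law has
    characteristic function proportional to (beta^2 / (beta^2 + u^2))^alpha. The quotient
    of its values at u and a u is a^(2 alpha) (1 - (1 - a^2) q)^(-alpha), and the binomial
    series expands it in powers of q. Repeated integration by parts and Banach's matchbox
    identity identify q^k with the Fourier transform of the density fbar_k with parameter
    beta / a. Hence the law with an atom of mass a^(2 alpha) at 0 and density the mixture
    of the fbar_k has the characteristic function of the remainder. The two laws are equal
    by uniqueness of characteristic functions, obtained by smoothing with Cauchy kernels. *)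

Require Import Defs.
From HB Require Import structures.
From mathcomp Require Import all_boot all_order all_algebra.
From mathcomp Require Import all_classical all_reals all_analysis.
From mathcomp Require Import complex.
From mathcomp Require Import measurable_realfun ring lra.

Set Implicit Arguments.
Unset Strict Implicit.

Import Order.TTheory GRing.Theory Num.Theory.
Import numFieldNormedType.Exports.

Local Open Scope classical_set_scope.
Local Open Scope ring_scope.

(** * The binomial series and the densities fbar *)

Section Binomial.
Context {R : realType}.
Implicit Types (alpha z : R) (n k : nat).

(** The bilateral law is that of a difference of two independent copies, so its characteristic
    function is |Phi|^2 for the gamma transform Phi. It is a positive real number, and real powers
    suffice although alpha need not be an integer. The hypothesis on P is only a functional
    equation: positivity permits the division, the constant in front of the bilateral characteristic
    function cancels (only its being nonzero is proved), and uniqueness turns the formula for the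
    quotient into a statement on measurable sets. The matchbox identity enters twice. At x = (b -
    iu)/(2b), y = (b + iu)/(2b) it is the partial fraction decomposition of (b^2/(b^2 + u^2))^n into
    powers of 1/(b - iu) and 1/(b + iu). At x = y = 1/2 it gives the total weight of the Erlang
    densities that make up [fbar], whence the bound b/2, uniform in the index, under which the
    mixture converges at every point. The Cauchy kernel suits the smoothing because it is the cosine
    transform of the gamma kernel of shape 1 and has the arctangent as primitive. *)

Lemma rising_binomial0 alpha : rising_binomial alpha 0 = 1.
Proof. by rewrite /rising_binomial big_ord0 fact0 divr1. Qed.

Lemma rising_binomialS alpha k :
  rising_binomial alpha k.+1 * k.+1%:R = rising_binomial alpha k * (alpha + k%:R).
Proof.
rewrite /rising_binomial big_ord_recr/= factS natrM.
have : k`!%:R != 0 :> R by rewrite pnatr_eq0 -lt0n fact_gt0.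
have : k.+1%:R != 0 :> R by rewrite pnatr_eq0.
move=> k0 f0; field; rewrite f0 /=.
by rewrite -natr1 in k0.
Qed.

(** Coefficient form of d/dz (1 - z)^-alpha = alpha (1 - z)^-(alpha+1). *)
Lemma rising_binomial_shift alpha k :
  rising_binomial alpha k.+1 * k.+1%:R = alpha * rising_binomial (alpha + 1) k.
Proof.
elim: k => [|k IH].
  by rewrite rising_binomialS !rising_binomial0; ring.
apply: (@mulIf _ k.+1%:R); first by rewrite pnatr_eq0.
rewrite rising_binomialS -mulrA [_ * k.+1%:R]mulrC mulrA IH -[RHS]mulrA.
rewrite rising_binomialS -!mulrA; congr (_ * (_ * _)).
by rewrite -[k.+1%:R]natr1; ring.
Qed.

Lemma rising_binomial_pascal alpha k :
  rising_binomial (alpha + 1) k.+1 =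
  rising_binomial alpha k.+1 + rising_binomial (alpha + 1) k.
Proof.
apply: (@mulIf _ k.+1%:R); first by rewrite pnatr_eq0.
rewrite mulrDl (rising_binomial_shift alpha) rising_binomialS -[k.+1%:R]natr1; ring.
Qed.

Lemma rising_binomial_ge0 alpha k : 0 <= alpha -> 0 <= rising_binomial alpha k.
Proof.
move=> a0; rewrite /rising_binomial divr_ge0 ?ler0n// prodr_ge0// => i _.
by rewrite addr_ge0.
Qed.

Lemma rising_binomial_le alpha1 alpha2 k : 0 <= alpha1 -> alpha1 <= alpha2 ->
  rising_binomial alpha1 k <= rising_binomial alpha2 k.
Proof.
move=> a0 a12; rewrite /rising_binomial ler_wpM2r ?invr_ge0 ?ler0n//.
by apply: ler_prod => i _; rewrite addr_ge0//= lerD2r.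
Qed.

Lemma rising_binomial0l k : rising_binomial (0 : R) k.+1 = 0.
Proof. by rewrite /rising_binomial big_ord_recl/= addr0 !mul0r. Qed.

(** Truncation of (1 - z)^-alpha = (1 - z) (1 - z)^-(alpha+1), by the Pascal rule. The boundary term
    is nonnegative for nonnegative alpha and z, which serves the bounds, and vanishes in the limit
    for z < 1, which gives the identity of the sums. *)
Lemma sum_rising_binomialD1 alpha z n :
  \sum_(0 <= k < n.+1) rising_binomial alpha k * z ^+ k =
  (1 - z) * \sum_(0 <= k < n.+1) rising_binomial (alpha + 1) k * z ^+ k
  + rising_binomial (alpha + 1) n * z ^+ n.+1.
Proof.
elim: n => [|n IH]; first by rewrite !big_nat1 !rising_binomial0; ring.
rewrite big_nat_recr//= IH [in RHS]big_nat_recr//= rising_binomial_pascal !exprS.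
ring.
Qed.

(** Induction on the integer exponent: dropping the nonnegative boundary term, each step costs a
    factor 1/(1 - z). *)
Lemma sum_rising_binomial_nat (z : R) N n : 0 <= z < 1 ->
  \sum_(0 <= k < n.+1) rising_binomial N%:R k * z ^+ k <= (1 - z) ^- N.
Proof.
move=> /andP[z0 z1]; elim: N => [|N IH].
  rewrite big_nat_recl// big1 ?addr0 ?rising_binomial0; last first.
    by move=> i _; rewrite rising_binomial0l mul0r.
  by rewrite invr1 mulr1.
rewrite exprS invfM ler_pdivlMl ?subr_gt0//.
apply: le_trans IH; rewrite (sum_rising_binomialD1 N%:R) natr1 lerDl.
by rewrite mulr_ge0 ?exprn_ge0 ?rising_binomial_ge0.
Qed.

(** The terms are nonnegative and increase with alpha, so the bound for an integer exponent N >
    alpha makes the partial sums converge. *)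
Lemma is_cvg_rising_binomial alpha z : 0 <= alpha -> 0 <= z < 1 ->
  cvgn (pseries (rising_binomial alpha) z).
Proof.
move=> a0 z01; have /andP[z0 z1] := z01.
apply: nondecreasing_is_cvgn.
  apply/nondecreasing_seqP => n; rewrite /pseries /series/= big_nat_recr//= lerDl.
  by rewrite mulr_ge0 ?exprn_ge0 ?rising_binomial_ge0.
pose N := (Num.trunc alpha).+1.
exists ((1 - z) ^- N) => _ [n _ <-].
rewrite /pseries /series/=.
apply: (@le_trans _ _ (\sum_(0 <= k < n.+1) rising_binomial N%:R k * z ^+ k)).
  rewrite big_nat_recr//=; apply: ler_wpDr.
    by rewrite mulr_ge0 ?exprn_ge0 ?rising_binomial_ge0.
  apply: ler_sum => i _; rewrite ler_wpM2r ?exprn_ge0// rising_binomial_le//.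
  by rewrite ltW// truncnS_gt.
exact: sum_rising_binomial_nat.
Qed.

Lemma pseries_diffs_rising_binomial alpha :
  pseries_diffs (rising_binomial alpha) = alpha *: rising_binomial (alpha + 1).
Proof.
by apply/funext => k; rewrite /pseries_diffs mulrC rising_binomial_shift.
Qed.

Lemma pseriesZ (c : R) (f : R^nat) z : pseries (c *: f) z = c *: pseries f z.
Proof.
apply/funext => n; rewrite /pseries /series.
transitivity (c * \sum_(0 <= i < n) f i * z ^+ i) => //; rewrite mulr_sumr.
by apply: eq_bigr => i _; rewrite mulrA.
Qed.

Lemma is_derive_rising_binomial alpha z : 0 <= alpha -> `|z| < 1 ->
  is_derive z (1 : R) (fun x => limn (pseries (rising_binomial alpha) x))
    (alpha * limn (pseries (rising_binomial (alpha + 1)) z)).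
Proof.
move=> a0 z1.
(* Termwise differentiation at z requires the series and its first two formal derivatives to
   converge at a point of larger modulus; the midpoint between |z| and 1 serves. *)
pose K := (1 + `|z|) / 2.
have zK : `|z| < K by rewrite /K; lra.
have K1 : 0 <= K < 1 by rewrite /K; apply/andP; split; have := normr_ge0 z; lra.
have cK b : 0 <= b -> cvgn (pseries (rising_binomial b) K).
  by move=> b0; exact: is_cvg_rising_binomial.
have cz b : 0 <= b -> cvgn (pseries (rising_binomial b) z).
  move=> b0; apply: (is_cvg_pseries_inside (cK b b0)).
  by rewrite (ger0_norm (proj1 (andP K1))).
have -> : alpha * limn (pseries (rising_binomial (alpha + 1)) z) =
   limn (pseries (pseries_diffs (rising_binomial alpha)) z).
  rewrite pseries_diffs_rising_binomial pseriesZ limZl_tmp//.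
  by apply: cz; rewrite addr_ge0.
apply: (@pseries_snd_diffs _ _ K); first exact: cK.
- rewrite pseries_diffs_rising_binomial pseriesZ; apply: is_cvgZl_tmp.
  by apply: cK; rewrite addr_ge0.
- have -> : pseries_diffs (pseries_diffs (rising_binomial alpha)) =
    (alpha * (alpha + 1)) *: rising_binomial (alpha + 1 + 1).
    rewrite pseries_diffs_rising_binomial -scalerA -pseries_diffs_rising_binomial.
    apply/funext => i.
rewrite [LHS]/(i.+1%:R * pseries_diffs (rising_binomial alpha) i.+1).
    rewrite pseries_diffs_rising_binomial.
    change (i.+1%:R * (alpha * rising_binomial (alpha + 1) i.+1) =
            alpha * ((alpha + 1) * rising_binomial (alpha + 1 + 1) i)).
    by rewrite mulrCA [i.+1%:R * _]mulrC rising_binomial_shift.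
  by rewrite pseriesZ; apply: is_cvgZl_tmp; apply: cK; rewrite !addr_ge0.
- by rewrite (ger0_norm (proj1 (andP K1))).
Qed.

Lemma lim_rising_binomialD1 alpha z : 0 <= alpha -> 0 <= z < 1 ->
  limn (pseries (rising_binomial alpha) z) =
  (1 - z) * limn (pseries (rising_binomial (alpha + 1)) z).
Proof.
move=> a0 z01.
have c1 : cvgn (pseries (rising_binomial (alpha + 1)) z).
  by apply: is_cvg_rising_binomial => //; rewrite addr_ge0.
have : pseries (rising_binomial alpha) z n.+1 @[n --> \oo] -->
    (1 - z) * limn (pseries (rising_binomial (alpha + 1)) z) + 0 * z.
  under eq_fun do rewrite /pseries /series /= sum_rising_binomialD1 exprSr mulrA.
  apply: cvgD; apply: cvgM; [exact: cvg_cst| |exact: cvg_series_cvg_0|exact: cvg_cst].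
  by rewrite (cvg_shiftS (pseries (rising_binomial (alpha + 1)) z)).
by rewrite (cvg_shiftS (pseries (rising_binomial alpha) z)) mul0r addr0 => /cvg_lim; apply.
Qed.

Lemma cvg_rising_binomial alpha z : 0 < alpha -> 0 <= z < 1 ->
  pseries (rising_binomial alpha) z @ \oo --> (1 - z) `^ (- alpha).
Proof.
move=> a_gt0 /andP[z0 z1]; have a0 := ltW a_gt0.
suff <- : limn (pseries (rising_binomial alpha) z) = (1 - z) `^ (- alpha).
  by apply: is_cvg_rising_binomial; rewrite // z0.
(* This product is constant: writing S_alpha for the sum, S_alpha' = alpha S_(alpha+1) and S_alpha =
   (1 - x) S_(alpha+1), so its derivative vanishes, and its value at 0 is 1. *)
pose f x := limn (pseries (rising_binomial alpha) x) * (1 - x) `^ alpha.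
have df (x : R) : 0 <= x < 1 -> is_derive x (1 : R) f 0.
  move=> /andP[x0 x1].
  have d1 : is_derive x (1 : R) (fun x => limn (pseries (rising_binomial alpha) x))
      (alpha * limn (pseries (rising_binomial (alpha + 1)) x)).
    by apply: is_derive_rising_binomial; rewrite // ger0_norm.
  have px : 0 < 1 - x by rewrite subr_gt0.
  have d2 : is_derive x (1 : R) (fun x : R => (1 - x)) (- 1).
    have := is_deriveB (is_derive_cst (1 : R) x (1 : R)) (is_derive_id x (1 : R)).
    by rewrite sub0r.
  have d3 := @is_derive1_comp _ (fun y => y `^ alpha) (fun x => 1 - x) x _ _
    (is_derive1_powR alpha px) d2.
  apply: (is_derive_eq (is_deriveM d1 d3)).
  rewrite lim_rising_binomialD1 ?x0// /GRing.scale/=.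
  have -> : (1 - x) `^ alpha = (1 - x) * (1 - x) `^ (alpha - 1).
    by rewrite mulr_powRB1// ltW.
  ring.
have f0 : f 0 = 1.
  rewrite /f subr0 powR1 mulr1; apply/cvg_lim => //.
  rewrite -cvg_shiftS (_ : (fun n => _) = fun=> 1); first exact: cvg_cst.
  apply/funext => n; rewrite /pseries /series /= big_nat_recl//= big1 ?addr0.
    by rewrite rising_binomial0 mulr1.
  by move=> i _; rewrite exprS mul0r mulr0.
have [c cz fz] : exists2 c, c \in `[0, z] & f z - f 0 = 0 * (z - 0).
  apply: (@MVT_segment _ _ (fun=> 0)) => //.
    move=> x; rewrite in_itv/= => /andP[x0 xz]; apply: df.
    by rewrite ltW//= (lt_trans xz).
  apply: derivable_within_continuous => x; rewrite in_itv/= => /andP[x0 xz].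
  by apply: ex_derive; apply: df; rewrite x0/= (le_lt_trans xz).
move: fz; rewrite mul0r f0 => /eqP; rewrite subr_eq0 => /eqP fz.
rewrite powRN; apply: (@mulIf _ ((1 - z) `^ alpha)).
  by rewrite gt_eqF// powR_gt0// subr_gt0.
by rewrite mulVf ?gt_eqF ?powR_gt0 ?subr_gt0.
Qed.

End Binomial.

(** * Banach's matchbox identity *)

Section MatchBox.

(* The recursion behind Banach's matchbox identity: with y = 1 - x, multiplying
   the truncated series of (1 - x)^-(n+2) by y lowers the exponent by one. *)
Lemma sum_bin_Xsubr (A : comNzRingType) (x : A) n m :
  (1 - x) * \sum_(j < m.+1) 'C(n.+1 + j, j)%:R * x ^+ j =
  \sum_(j < m.+1) 'C(n + j, j)%:R * x ^+ j - 'C(n.+1 + m, m)%:R * x ^+ m.+1.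
Proof.
elim: m => [|m IH]; first by rewrite !big_ord1 !bin0; ring.
rewrite big_ord_recr mulrDr IH [in RHS]big_ord_recr/=.
have -> : 'C(n.+1 + m.+1, m.+1) = ('C(n + m.+1, m.+1) + 'C(n.+1 + m, m))%N.
  by rewrite addSn binS addSnnS.
rewrite natrD [x ^+ m.+2]exprS; ring.
Qed.

(** For probabilities x and y of the two outcomes of a trial, the sum is the total probability that
    one of them is the first to occur n+1 times, j counting the occurrences of the other. The
    algebraic proof is needed because complex x and y are used as well. *)
Lemma matchbox_identity (A : comNzRingType) (x y : A) n : x + y = 1 ->
  \sum_(j < n.+1) 'C(n + j, j)%:R * (x ^+ j * y ^+ n.+1 + y ^+ j * x ^+ n.+1) = 1.
Proof.
move=> xy.
have yE : y = 1 - x by rewrite -xy addrC addKr.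
have xE : x = 1 - y by rewrite -xy addrK.
pose S (z : A) m := \sum_(j < m.+1) 'C(m + j, j)%:R * z ^+ j.
have SE m : \sum_(j < m.+1) 'C(m + j, j)%:R * (x ^+ j * y ^+ m.+1 + y ^+ j * x ^+ m.+1)
    = y ^+ m.+1 * S x m + x ^+ m.+1 * S y m.
  rewrite /S !mulr_sumr -big_split/=; apply: eq_bigr => j _; ring.
(* One step from m to m+1 produces error terms proportional to 1 - 2x and 1 - 2y, with the same
   coefficient once weighted by the powers of y and x; they cancel because x + y = 1. *)
have SS z m : (1 - z) * S z m.+1 =
    S z m + 'C(m + m.+1, m.+1)%:R * z ^+ m.+1 * (1 - z *+ 2).
  rewrite /S sum_bin_Xsubr big_ord_recr/=.
  rewrite addSn binS natrD -(@bin_sub _ m) ?leq_addr//.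
  rewrite addKn [z ^+ m.+2]exprS; ring.
rewrite SE; elim: n => [|n IH].
  by rewrite /S !big_ord1 !bin0 !mul1r !expr0 !mulr1 !expr1 addrC.
rewrite [y ^+ _]exprSr [x ^+ n.+2]exprSr -!mulrA.
have := SS x n; have := SS y n; rewrite -yE -xE => -> ->.
have -> : 1 - y *+ 2 = - (1 - x *+ 2) by rewrite yE; ring.
rewrite -IH; ring.
Qed.

End MatchBox.

(** * The densities fbar as mixtures of Erlang densities *)

Section Fbar.
Context {R : realType}.
Implicit Types (b x u : R) (n : nat).

(** The j-th term carries the Erlang density of shape n - j + 1 and rate b at |x|; its weight is the
    matchbox probability at x = y = 1/2 for one of the two outcomes. *)
Lemma fbarE n b x : b != 0 -> x != 0 -> fbar n.+1 b x =
  \sum_(j < n.+1) 'C(n + j, j)%:R / 2 ^+ (n.+1 + j) *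
    (b * ((b * `|x|) ^+ (n - j) / (n - j)`!%:R) * expR (- (b * `|x|))).
Proof.
move=> b0 x0; rewrite /fbar [n.+1.-1]/= mulr_sumr; apply: eq_bigr => j _.
have jn : (j <= n)%N by rewrite -ltnS.
have nf k : k`!%:R != 0 :> R by rewrite pnatr_eq0 -lt0n fact_gt0.
have nx : `|x| != 0 by rewrite normr_eq0.
have -> : (n + j)`!%:R = 'C(n + j, j)%:R * (j`!%:R * n`!%:R) :> R.
  by rewrite -!natrM -(@bin_fact (n + j) j) ?leq_addl// addnK.
have -> : (b * `|x|) ^+ n = (b * `|x|) ^+ (n - j) * (b * `|x|) ^+ j.
  by rewrite -exprD subnK.
rewrite natrM exprD !exprMn; set d := (_ ^+ (n - j)); field.
by rewrite !nf ?expf_neq0 ?pnatr_eq0.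
Qed.

Lemma fbar_ge0 n b x : 0 <= b -> 0 <= fbar n b x.
Proof.
move=> b0; rewrite /fbar mulr_ge0//.
  by rewrite !mulr_ge0 ?expR_ge0 ?invr_ge0 ?exprn_ge0 ?mulr_ge0 ?exprn_ge0.
apply: sumr_ge0 => j _.
by rewrite !mulr_ge0 ?invr_ge0 ?mulr_ge0 ?exprn_ge0 ?mulr_ge0.
Qed.

(** The Erlang form fails at 0 for n > 0: there the factor (b|x|)^n in the definition is 0, so the
    value is 0, and it is b/2 only for n = 0. *)
Lemma fbar0 n b : 0 <= b -> fbar n.+1 b 0 <= b / 2.
Proof.
move=> b0; case: n => [|n].
  rewrite /fbar/= big_ord1 normr0 !mulr0 oppr0 expR0 !expr0 fact0 !mulr1.
  by rewrite expr1 muln1 divr1 mulr1.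
by rewrite /fbar /= normr0 mulr0 expr0n/= !(mulr0, mul0r) divr_ge0.
Qed.

Lemma exp_coeff_le_expR n (y : R) : 0 <= y -> y ^+ n / n`!%:R <= expR y.
Proof.
move=> y0; case: n => [|n].
  by rewrite expr0 fact0 divr1; apply: le_trans (expR_ge1Dx y); rewrite lerDl.
by apply: le_trans (expR_ge1Dxn n y0); rewrite lerDr.
Qed.

Lemma fbar_le n b x : 0 < b -> fbar n.+1 b x <= b / 2.
Proof.
move=> b0; have [->|x0] := eqVneq x 0; first by rewrite fbar0// ltW.
have b00 : b != 0 by rewrite gt_eqF.
rewrite fbarE//.
have H := @matchbox_identity R 2^-1 2^-1 n.
(* The matchbox identity at x = y = 1/2: the weights sum to 1/2. Each Erlang density is at most b,
   since y^m/m! is at most the exponential of y. *)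
have {}H : \sum_(j < n.+1) 'C(n + j, j)%:R / 2 ^+ (n.+1 + j) = 2^-1 :> R.
  apply: (@mulfI _ 2) => //; rewrite divff// -[RHS]H; last lra.
  rewrite mulr_sumr; apply: eq_bigr => j _.
  rewrite -exprD [(j + _)%N]addnC exprVn; ring.
rewrite -H mulr_sumr; apply: ler_sum => j _; rewrite [leRHS]mulrC.
rewrite ler_wpM2l ?mulr_ge0 ?invr_ge0 ?exprn_ge0//.
rewrite -mulrA ler_piMr ?(ltW b0)//.
rewrite expRN ler_pdivrMr ?expR_gt0// mul1r; apply: exp_coeff_le_expR.
by rewrite mulr_ge0// ltW.
Qed.

Lemma measurable_fbar n b : measurable_fun [set: R] (fbar n b).
Proof.
apply: measurable_funM.
  apply: measurable_funM.
    apply: measurable_funM => //; apply: measurable_funX.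
    by apply: measurable_funM.
  apply: measurableT_comp => //; apply: measurableT_comp => //.
  by apply: measurable_funM.
apply: measurable_sum => j; apply: measurable_funM => //.
under eq_fun do rewrite invfM -exprVn.
apply: measurable_funM => //; apply: measurable_funX.
under eq_fun do rewrite -powR_inv1//.
exact: (measurableT_comp (measurable_powR (- 1 : R))).
Qed.

End Fbar.

(** * Fourier integrals of gamma kernels *)

Lemma cvg_Rintegral_dominated d (T : measurableType d) (R : realType)
    (mu : {measure set T -> \bar R}) (D : set T) (mD : measurable D)
    (f_ : nat -> T -> R) (f g : T -> R) :
  (forall n, measurable_fun D (f_ n)) ->
  (forall x, D x -> f_ ^~ x @ \oo --> f x) ->
  mu.-integrable D (EFin \o g) ->
  (forall n x, D x -> `|f_ n x| <= g x) ->
  mu.-integrable D (EFin \o f) /\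
  \int[mu]_(x in D) f_ n x @[n --> \oo] --> \int[mu]_(x in D) f x.
Proof.
move=> mf_ f_f ig f_g.
have mf : measurable_fun D f by exact: measurable_fun_cvg f_f.
have [||||| intf _] := @dominated_convergence _ _ R mu _ mD
  (fun n x => (f_ n x)%:E) (EFin \o f) (EFin \o g).
- by move=> n; apply/measurable_EFinP.
- exact/measurable_EFinP.
- by apply: aeW => x Dx; apply: cvg_EFin; [exact: nearW|exact: f_f].
- exact: ig.
- by apply: aeW => x n Dx; rewrite lee_fin f_g.
move=> h; split => //; apply: fine_cvg; rewrite fineK//.
exact: integrable_fin_num.
Qed.

Lemma integrable_scaler d (T : measurableType d) (R : realType)
    (mu : {measure set T -> \bar R}) (D : set T) (mD : measurable D) (k : R) (f : T -> R) :
  mu.-integrable D (EFin \o f) -> mu.-integrable D (EFin \o (fun x => k * f x)).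
Proof. exact: integrableZl. Qed.

Lemma integrable_addr d (T : measurableType d) (R : realType)
    (mu : {measure set T -> \bar R}) (D : set T) (mD : measurable D) (f g : T -> R) :
  mu.-integrable D (EFin \o f) -> mu.-integrable D (EFin \o g) ->
  mu.-integrable D (EFin \o (fun x => f x + g x)).
Proof. exact: integrableD. Qed.

(** * The fundamental theorem of calculus on the open half line *)

Section HalfLineFTC.
Context {R : realType}.
Local Notation leb := (@lebesgue_measure R).
Implicit Types (f F : R -> R) (A B : R).

(** Compact exhaustion that avoids 0, where gamma kernels of shape below 1 are singular. The offset
    2 keeps the end points distinct already for n = 0. *)
Let itv n : set R := `[n.+2%:R^-1, n.+2%:R].

Let itv_nondecreasing : nondecreasing_seq itv.
Proof.
apply/nondecreasing_seqP => n; apply/subsetPset => x.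
rewrite /itv /= !in_itv/= => /andP[nx xn]; apply/andP; split.
  by apply: le_trans nx; rewrite lef_pV2 ?posrE// ler_nat.
by apply: (le_trans xn); rewrite ler_nat.
Qed.

Let itv_gt0 n x : itv n x -> 0 < x.
Proof. by rewrite /itv/= in_itv/= => /andP[nx _]; apply: lt_le_trans nx. Qed.

Let bigcup_itv0y x : 0 < x -> (\bigcup_n itv n) x.
Proof.
move=> x0; exists (Num.trunc (x + x^-1)) => //; rewrite /itv/= in_itv/=.
have h : x + x^-1 < (Num.trunc (x + x^-1)).+2%:R.
  by apply: lt_trans (truncnS_gt _) _; rewrite ltr_nat.
apply/andP; split.
  rewrite -[leRHS]invrK lef_pV2 ?posrE ?invr_gt0// ltW//.
  by apply: le_lt_trans h; rewrite lerDr ltW.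
by rewrite ltW//; apply: le_lt_trans h; rewrite lerDl invr_ge0 ltW.
Qed.

Let bigcup_itv : \bigcup_n itv n = `]0, +oo[%classic.
Proof.
apply/seteqP; split => [x [n _ /itv_gt0 x0]|x]; rewrite /= in_itv/= ?x0//.
by rewrite andbT; exact: bigcup_itv0y.
Qed.

Let FTC_itv f F (n : nat) : (forall x : R, 0 < x -> is_derive x (1 : R) F (f x)) ->
  {in `]0%R, +oo[, continuous f} ->
  (\int[leb]_(x in itv n) (f x)%:E = (F n.+2%:R - F n.+2%:R^-1)%:E)%E.
Proof.
move=> dF cf; rewrite EFinB.
have F0 x : 0 < x -> {for x, continuous F}.
  by move=> x0; apply/differentiable_continuous/derivable1_diffP; case: (dF x x0).
have n0 : 0 < n.+2%:R^-1 :> R by rewrite invr_gt0.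
have n1 : n.+2%:R^-1 < n.+2%:R :> R.
  by rewrite (@lt_trans _ _ 1) ?invf_lt1 ?ltr1n.
apply: continuous_FTC2 => //.
- apply: continuous_in_subspaceT => x /[!inE] /itv_gt0 x0; apply: cf.
  by rewrite in_itv/= x0.
- split.
  + move=> x; rewrite in_itv/= => /andP[nx _].
    by case: (dF x (lt_trans n0 nx)).
  + by apply: cvg_at_right_filter; apply: F0.
  + by apply: cvg_at_left_filter; apply: F0; rewrite ltr0n.
- move=> x; rewrite in_itv/= => /andP[nx _].
  by rewrite derive1E; case: (dF x (lt_trans n0 nx)).
Qed.

Let cvg_FTC F A B : F x @[x --> 0^'+] --> A -> F x @[x --> +oo] --> B ->
  (F n.+2%:R - F n.+2%:R^-1) @[n --> \oo] --> B - A.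
Proof.
move=> FA FB; apply: cvgB.
  move/cvg_pinftyP : FB; apply.
  have := @cvgr_idn R; rewrite -(cvg_shiftn 2).
  by under eq_fun do rewrite addn2.
move/cvg_at_rightP : FA; apply; split => [n|]; first by rewrite invr_gt0 ltr0n.
by rewrite (cvg_shiftS (harmonic : R^nat)); exact: cvg_harmonic.
Qed.

Let measurable_itv0y f : {in `]0%R, +oo[, continuous f} ->
  measurable_fun (`]0%R, +oo[%classic : set R) f.
Proof.
by move=> cf; apply: open_continuous_measurable_fun => // x; rewrite inE; exact: cf.
Qed.

(** Monotone convergence over the exhaustion. Since integrability is a consequence here, this
    version provides the dominating function for the gamma kernels; the signed version below relies
    on dominated convergence. *)
Lemma ge0_FTC_itv0y f F A B :
  (forall x : R, 0 < x -> is_derive x (1 : R) F (f x)) ->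
  {in `]0%R, +oo[, continuous f} ->
  F x @[x --> 0^'+] --> A -> F x @[x --> +oo] --> B ->
  (forall x, 0 < x -> 0 <= f x) ->
  (\int[leb]_(x in `]0%R, +oo[) (f x)%:E = (B - A)%:E)%E.
Proof.
move=> dF cf FA FB f0; rewrite -bigcup_itv.
have h1 : (\int[leb]_(x in itv n) (f x)%:E)%E @[n --> \oo] -->
    (\int[leb]_(x in \bigcup_n itv n) (f x)%:E)%E.
  apply: (@ge0_nondecreasing_set_cvg_integral _ (measurableTypeR R) R itv
    (EFin \o f) leb itv_nondecreasing).
  - by move=> n; exact: measurable_itv.
  - move=> n; apply/measurable_EFinP.
    apply: measurable_funS (measurable_itv0y cf) => //.
    by move=> x /itv_gt0 x0; rewrite /= in_itv/= x0.
  - by move=> n x /itv_gt0 x0; rewrite lee_fin; exact: f0.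
have h2 : (\int[leb]_(x in itv n) (f x)%:E)%E @[n --> \oo] --> (B - A)%:E.
  under eq_fun do rewrite (FTC_itv _ dF cf).
  by apply: cvg_EFin; [exact: nearW|exact: cvg_FTC].
exact: (cvg_unique _ h1 h2).
Qed.

Lemma FTC_itv0y f F A B :
  (forall x : R, 0 < x -> is_derive x (1 : R) F (f x)) ->
  {in `]0%R, +oo[, continuous f} ->
  F x @[x --> 0^'+] --> A -> F x @[x --> +oo] --> B ->
  leb.-integrable `]0%R, +oo[ (EFin \o f) ->
  (\int[leb]_(x in `]0%R, +oo[) f x)%R = B - A.
Proof.
move=> dF cf FA FB intf.
have mD : measurable (`]0%R, +oo[%classic : set R) by exact: measurable_itv.
have E n : (\int[leb]_(x in `]0%R, +oo[) (f \_ (itv n) x)%:E)%E =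
    (F n.+2%:R - F n.+2%:R^-1)%:E.
  rewrite -FTC_itv// [RHS]integral_mkcond [LHS]integral_mkcond.
  apply: eq_integral => x _; rewrite !patchE.
  case: ifPn => [xi|/negP xi]; first by case: ifPn.
  case: ifPn => [|//]; rewrite inE => /itv_gt0 x0; exfalso; apply: xi.
  by rewrite inE/= in_itv/= x0.
have [|||_ h] := @cvg_Rintegral_dominated _ (measurableTypeR R) R leb _ mD
  (fun n => f \_ (itv n)) f (Num.norm \o f) _ _ (integrable_norm intf) _.
- move=> n; apply: measurable_funTS => /=.
  apply/(measurable_restrictT f (measurable_itv _)).
  apply: measurable_funS (measurable_itv0y cf) => //.
  by move=> x /itv_gt0 x0; rewrite /= in_itv/= x0.
- move=> x; rewrite /= in_itv/= andbT => x0.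
  have [N _ Nx] := bigcup_itv0y x0.
  apply: cvg_near_cst; exists N => // n /= Nn; rewrite patchE mem_set//.
  by have /subsetPset := itv_nondecreasing Nn; exact.
- move=> n x _; rewrite patchE; case: ifPn => // _.
  by change (`|0 : R| <= `|f x|); rewrite normr0.
have h2 := cvg_FTC FA FB.
have {}h2 : \int[leb]_(x in `]0%R, +oo[) (f \_ (itv n)) x @[n --> \oo] --> B - A.
  by under eq_fun do rewrite /Rintegral E /=.
exact: (cvg_unique _ h h2).
Qed.

End HalfLineFTC.

(** * Gamma kernels and their cosine and sine transforms *)

Section GammaKernel.
Context {R : realType}.
Local Notation leb := (@lebesgue_measure R).
Implicit Types (alpha beta c u x y : R).

Definition gamma_kernel alpha beta x := x `^ (alpha - 1) * expR (- (beta * x)).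

Lemma gamma_kernel_ge0 alpha beta x : 0 <= gamma_kernel alpha beta x.
Proof. by rewrite mulr_ge0 ?powR_ge0 ?expR_ge0. Qed.

Lemma measurable_gamma_kernel alpha beta :
  measurable_fun [set: R] (gamma_kernel alpha beta).
Proof.
apply: measurable_funM; first exact: measurable_powR.
by apply: measurableT_comp => //; apply: measurableT_comp.
Qed.

Lemma gamma_kernelD1 alpha beta x : 0 < x ->
  gamma_kernel (alpha + 1) beta x = x * gamma_kernel alpha beta x.
Proof.
move=> x0; rewrite /gamma_kernel addrK mulrA; congr (_ * _).
transitivity (x `^ (1 + (alpha - 1))); first by rewrite addrC subrK.
by rewrite [LHS]powRD ?(gt_eqF x0) ?implybT// powRr1// ltW.
Qed.

(** This is y^n/n! <= e^y at y = c(1 + x); the factor e^c absorbs the shift by 1. *)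
Lemma exprn_le_expR c n x : 0 < c -> 0 <= x ->
  (1 + x) ^+ n <= n`!%:R / c ^+ n * expR c * expR (c * x).
Proof.
move=> c0 x0; rewrite -[leRHS]mulrA -expRD mulrAC ler_pdivlMr ?exprn_gt0//.
rewrite -exprMn mulrC -ler_pdivrMl ?ltr0n ?fact_gt0//.
rewrite (_ : c + c * x = c * (1 + x)); last by ring.
by rewrite [leLHS]mulrC exp_coeff_le_expR// mulr_ge0 ?addr_ge0// ltW.
Qed.

Lemma powR_le_exprn alpha x : 0 <= alpha -> 0 <= x ->
  x `^ alpha <= (1 + x) ^+ (Num.trunc alpha).+1.
Proof.
move=> a0 x0; rewrite -powR_mulrn ?addr_ge0//.
apply: (@le_trans _ _ ((1 + x) `^ alpha)).
  by rewrite ge0_ler_powR ?nnegrE ?addr_ge0// lerDr.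
by rewrite ler_powR ?lerDl// ltW// truncnS_gt.
Qed.

(* (1 + x^alpha)^-2 x^(alpha-1) has the explicit bounded primitive
   -1/(alpha (1 + x^alpha)), whence its use as dominating function. *)
Lemma gamma_kernel_le alpha beta : 0 < alpha -> 0 < beta ->
  exists2 C, 0 <= C & forall x, 0 <= x ->
    gamma_kernel alpha beta x <= C * (x `^ (alpha - 1) / (1 + x `^ alpha) ^+ 2).
Proof.
move=> a0 b0; set N := (Num.trunc alpha).+1.
(* From 1 + x^alpha <= 2 (1 + x)^N, the square is at most 4 (1 + x)^(2N), which [exprn_le_expR]
   compares with the exponential of rate beta. *)
exists (4 * ((N * 2)`!%:R / beta ^+ (N * 2) * expR beta)).
  by rewrite !mulr_ge0 ?expR_ge0 ?invr_ge0 ?exprn_ge0 ?ltW.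
move=> x x0; rewrite /gamma_kernel mulrCA ler_wpM2l ?powR_ge0//.
rewrite expRN -[_^-1]mul1r ler_pdivrMr ?expR_gt0// mulrAC ler_pdivlMr; last first.
  by rewrite exprn_gt0// ltr_wpDr ?powR_ge0.
rewrite mul1r -mulrA.
apply: (@le_trans _ _ ((2 * (1 + x) ^+ N) ^+ 2)).
  rewrite lerXn2r ?nnegrE ?addr_ge0 ?powR_ge0 ?mulr_ge0 ?exprn_ge0 ?addr_ge0//.
  rewrite mulr2n mulrDl mul1r lerD ?powR_le_exprn ?(ltW a0)//.
  by rewrite exprn_ege1// lerDl.
rewrite exprMn -exprM (_ : 2 ^+ 2 = 4); last by rewrite -natrX.
by rewrite -[leRHS]mulrA ler_wpM2l// [X in X * expR _]mulrA exprn_le_expR.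
Qed.

Lemma cvgry_powR alpha : 0 < alpha -> x `^ alpha @[x --> +oo] --> +oo.
Proof.
move=> a0; apply/cvgryPge => A; near=> x.
apply: (@le_trans _ _ (((Num.max A 1) `^ alpha^-1) `^ alpha)).
  by rewrite -powRrM mulVf ?gt_eqF// powRr1 ?le_max ?lexx ?ler01 ?orbT.
rewrite ge0_ler_powR ?nnegrE ?powR_ge0// ?(ltW a0)//.
Unshelve. all: by end_near. Qed.

Lemma integrable_gamma_kernel alpha beta : 0 < alpha -> 0 < beta ->
  leb.-integrable `]0%R, +oo[ (EFin \o gamma_kernel alpha beta).
Proof.
move=> a0 b0; have [C C0 gC] := gamma_kernel_le a0 b0.
pose h x : R := x `^ (alpha - 1) / (1 + x `^ alpha) ^+ 2.
pose F x : R := - (alpha * (1 + x `^ alpha))^-1.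
have h0 x : 0 <= h x.
  by rewrite mulr_ge0 ?invr_ge0 ?exprn_ge0 ?addr_ge0 ?powR_ge0.
have cpow x (p : R) : 0 < x -> {for x, continuous (fun x : R => x `^ p)}.
  move=> x0; apply/differentiable_continuous/derivable1_diffP.
  by case: (is_derive1_powR p x0).
have ch : {in `]0%R, +oo[, continuous h}.
  move=> x; rewrite in_itv/= andbT => x0.
  apply: cvgM; first exact: cpow.
  apply: cvgV.
    by rewrite gt_eqF// exprn_gt0// ltr_wpDr ?powR_ge0.
  apply: (@continuous_comp _ _ _ (fun x => 1 + x `^ alpha) (fun y => y ^+ 2)).
    by apply: cvgD; [exact: cvg_cst|exact: cpow].
  exact: exprn_continuous.
have inth : (\int[leb]_(x in `]0%R, +oo[) (h x)%:E = (0 - (- alpha^-1))%:E)%E.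
  apply: (@ge0_FTC_itv0y _ h F) => //.
  - move=> x x0; rewrite /F.
    have px : 0 < 1 + x `^ alpha by rewrite ltr_wpDr ?powR_ge0.
    have d1 := is_deriveD (is_derive_cst (1 : R) x (1 : R)) (is_derive1_powR alpha x0).
    have d2 := is_deriveZ alpha d1.
    have d3 := is_deriveN (@is_deriveV _ (fun y => alpha * (1 + y `^ alpha)) _ _ _ (lt0r_neq0 (mulr_gt0 a0 px)) d2).
    apply: (is_derive_eq d3); rewrite /h add0r /GRing.scale/=.
    by field; rewrite !gt_eqF.
  - rewrite /F -[alpha in X in _ --> X]mulr1 -[X in _ * X]addr0.
    apply: cvgN; apply: cvgV; first by rewrite addr0 mulr1 gt_eqF.
    by apply: cvgMr; apply: cvgD; [exact: cvg_cst|exact: powR_cvg0].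
  - rewrite /F -[X in _ --> X]oppr0; apply: cvgN.
    apply/gtr0_cvgV0.
      by apply: nearW => x; rewrite mulr_gt0// ltr_wpDr ?powR_ge0.
    apply: gt0_cvgMry => //; apply/cvgryPge => A; near=> x.
    rewrite ler_wpDl//; near: x; move: A; apply/cvgryPge.
    exact: cvgry_powR.
have ih : leb.-integrable `]0%R, +oo[ (EFin \o h).
  apply/integrableP; split.
    apply/measurable_EFinP; apply: open_continuous_measurable_fun => //.
    by move=> x; rewrite inE; exact: ch.
  under eq_integral do rewrite /= ger0_norm//.
  by rewrite inth ltry.
apply: (@le_integrable _ _ _ leb _ _ _ (EFin \o (fun x => C * h x))) => //.
- by apply/measurable_EFinP; apply: measurable_funTS; exact: measurable_gamma_kernel.
- move=> x; rewrite /= in_itv/= andbT => x0; rewrite lee_fin.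
  rewrite ger0_norm ?gamma_kernel_ge0// ger0_norm ?(mulr_ge0 C0 (h0 x))//.
  exact: gC (ltW x0).
- rewrite (_ : _ \o _ = fun x => C%:E * (EFin \o h) x)%E//.
  exact: integrableZl.
Unshelve. all: by end_near. Qed.

Local Notation pos := (`]0%R, +oo[%classic : set R).

Lemma integrable_gamma_kernelM alpha beta (h : R -> R) : 0 < alpha -> 0 < beta ->
  measurable_fun [set: R] h -> (forall x, `|h x| <= 1) ->
  leb.-integrable `]0%R, +oo[ (EFin \o (fun x => gamma_kernel alpha beta x * h x)).
Proof.
move=> a0 b0 mh h1.
apply: (le_integrable _ _ _ (integrable_gamma_kernel a0 b0)) => //.
  apply/measurable_EFinP; apply: measurable_funTS; apply: measurable_funM => //.
  exact: measurable_gamma_kernel.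
by move=> x _; rewrite /= lee_fin normrM ler_piMr.
Qed.

Lemma norm_cos_le1 x : `|cos x| <= 1.
Proof. by rewrite ler_norml cos_geN1 cos_le1. Qed.

Lemma norm_sin_le1 x : `|sin x| <= 1.
Proof. by rewrite ler_norml sin_geN1 sin_le1. Qed.

Lemma is_derive_cosM u x : is_derive x (1 : R) (fun y => cos (u * y)) (- u * sin (u * x)).
Proof.
have d1 := is_deriveZ u (is_derive_id x (1 : R)).
apply: (is_derive_eq (@is_derive1_comp _ cos (fun y => u * y) x _ _ (is_derive_cos _) d1)).
by rewrite /GRing.scale/=; ring.
Qed.

Lemma is_derive_sinM u x : is_derive x (1 : R) (fun y => sin (u * y)) (u * cos (u * x)).
Proof.
have d1 := is_deriveZ u (is_derive_id x (1 : R)).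
apply: (is_derive_eq (@is_derive1_comp _ sin (fun y => u * y) x _ _ (is_derive_sin _) d1)).
by rewrite /GRing.scale/=; ring.
Qed.

Lemma measurable_cosM u : measurable_fun [set: R] (fun x => cos (u * x)).
Proof.
apply: continuous_measurable_fun => x; apply/differentiable_continuous.
by apply/derivable1_diffP; case: (is_derive_cosM u x).
Qed.

Lemma measurable_sinM u : measurable_fun [set: R] (fun x => sin (u * x)).
Proof.
apply: continuous_measurable_fun => x; apply/differentiable_continuous.
by apply/derivable1_diffP; case: (is_derive_sinM u x).
Qed.

Lemma is_derive_gamma_kernel alpha beta x : 0 < x ->
  is_derive x (1 : R) (gamma_kernel (alpha + 1) beta)
    (alpha * gamma_kernel alpha beta x - beta * gamma_kernel (alpha + 1) beta x).
Proof.
move=> x0.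
have d1 := is_deriveN (is_deriveZ beta (is_derive_id x (1 : R))).
have d2 := @is_derive1_comp _ expR (fun y => - (beta * y)) x _ _ (is_derive_expR _) d1.
apply: (is_derive_eq (is_deriveM (is_derive1_powR (alpha + 1 - 1) x0) d2)).
by rewrite /gamma_kernel /GRing.scale/= !addrK; ring.
Qed.

Lemma continuous_gamma_kernel alpha beta x : 0 < x ->
  {for x, continuous (gamma_kernel alpha beta)}.
Proof.
move=> x0; apply/differentiable_continuous/derivable1_diffP.
have := is_derive_gamma_kernel (alpha - 1) beta x0.
by rewrite subrK => -[].
Qed.

Lemma cvgy_gamma_kernel alpha beta : 1 <= alpha -> 0 < beta ->
  gamma_kernel alpha beta x @[x --> +oo] --> (0 : R).
Proof.
move=> a1 b0; set N := (Num.trunc (alpha - 1)).+1.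
(* x times x^(alpha-1) is at most (1 + x)^(N+1), so the kernel is bounded by M/x. *)
pose M := N.+1`!%:R / beta ^+ N.+1 * expR beta.
have M0 : 0 <= M by rewrite !mulr_ge0 ?expR_ge0 ?invr_ge0 ?exprn_ge0 ?ltW.
apply: (@squeeze_cvgr _ _ _ _ (fun=> 0) (fun x => M * x^-1)).
- near=> x; have x0 : 0 < x by near: x; apply: nbhs_pinfty_gt.
  rewrite gamma_kernel_ge0/= ler_pdivlMr// /gamma_kernel expRN mulrAC.
  rewrite ler_pdivrMr ?expR_gt0//.
  apply: (@le_trans _ _ ((1 + x) ^+ N.+1)); last exact: exprn_le_expR (ltW x0).
  rewrite exprSr ler_pM ?powR_ge0 ?(ltW x0)//; last by rewrite lerDr.
  by apply: powR_le_exprn; [rewrite subr_ge0|exact: ltW].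
- exact: cvg_cst.
- rewrite -(mulr0 M); apply: cvgMr; apply/gtr0_cvgV0 => //.
  by apply: nbhs_pinfty_gt.
Unshelve. all: by end_near. Qed.

Lemma cvg_mul_bounded (T : Type) (G : set_system T) (FG : Filter G) (f h : T -> R) :
  (forall t, `|h t| <= 1) -> f x @[x --> G] --> (0 : R) -> f x * h x @[x --> G] --> (0 : R).
Proof.
move=> h1 f0; apply/(@norm_cvg0P _ _ _ G FG).
have {}f0 : `|f x| @[x --> G] --> (0 : R) := (@norm_cvg0P _ _ _ G FG f).2 f0.
have : `|f x * h x| @[x --> G] --> (0 : R).
  apply: (squeeze_cvgr _ (cvg_cst (0 : R)) f0).
  by apply: nearW => x; rewrite normr_ge0 normrM ler_piMr.
exact.
Qed.

Definition gamma_cos alpha beta u : R :=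
  \int[leb]_(x in `]0%R, +oo[) (gamma_kernel alpha beta x * cos (u * x)).

Definition gamma_sin alpha beta u : R :=
  \int[leb]_(x in `]0%R, +oo[) (gamma_kernel alpha beta x * sin (u * x)).

Lemma RintegralD3 (D : set (measurableTypeR R)) (a b c : R) (f g h : R -> R) :
  measurable D ->
  leb.-integrable D (EFin \o f) -> leb.-integrable D (EFin \o g) ->
  leb.-integrable D (EFin \o h) ->
  leb.-integrable D (EFin \o (fun x => a * f x + b * g x + c * h x)) /\
  \int[leb]_(x in D) (a * f x + b * g x + c * h x) =
  a * (\int[leb]_(x in D) f x) + b * (\int[leb]_(x in D) g x)
  + c * (\int[leb]_(x in D) h x).
Proof.
move=> mD If Ig Ih.
have Z k w := @integrable_scaler _ (measurableTypeR R) R leb D mD k w.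
have A w w' := @integrable_addr _ (measurableTypeR R) R leb D mD w w'.
have I2 := A _ _ (Z a _ If) (Z b _ Ig).
split; first exact: A _ _ I2 (Z c _ Ih).
rewrite RintegralD//; last exact: Z.
by rewrite RintegralD ?RintegralZl//; exact: Z.
Qed.

(** Integrates the derivative of the kernel of shape alpha + 1 times h. The factor alpha stays under
    the integral so that alpha = 0 is allowed, where the kernel x^-1 is not integrable. The boundary
    limit l at 0 vanishes for alpha > 0 but is h(0) for alpha = 0, which starts the recursion. *)
Lemma gamma_by_parts alpha beta (h dh : R -> R) (l m : R) : 0 <= alpha -> 0 < beta ->
  leb.-integrable `]0%R, +oo[ (EFin \o (fun x => alpha * (gamma_kernel alpha beta x * h x))) ->
  gamma_kernel (alpha + 1) beta x * h x @[x --> 0^'+] --> l ->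
  (forall x : R, is_derive x (1 : R) h (m * dh x)) ->
  continuous dh ->
  (forall x, `|h x| <= 1) -> (forall x, `|dh x| <= 1) ->
  (\int[leb]_(x in `]0%R, +oo[) (alpha * (gamma_kernel alpha beta x * h x)))%R + l =
  beta * (\int[leb]_(x in `]0%R, +oo[) (gamma_kernel (alpha + 1) beta x * h x))
  - m * (\int[leb]_(x in `]0%R, +oo[) (gamma_kernel (alpha + 1) beta x * dh x)).
Proof.
move=> a0 b0 I0 hl dh' cdh h1 dh1.
have mD : measurable (`]0%R, +oo[%classic : set (measurableTypeR R)).
  exact: measurable_itv.
have ch : continuous h.
  move=> x; apply/differentiable_continuous/derivable1_diffP.
  by case: (dh' x).
have a1 : 0 < alpha + 1 by rewrite ltr_wpDl.
have I1 := integrable_gamma_kernelM a1 b0 (continuous_measurable_fun ch) h1.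
have I2 := integrable_gamma_kernelM a1 b0 (continuous_measurable_fun cdh) dh1.
have [I E] := RintegralD3 1 (- beta) m mD I0 I1 I2.
have F : (\int[leb]_(x in `]0%R, +oo[) (1 * (alpha * (gamma_kernel alpha beta x * h x))
   + - beta * (gamma_kernel (alpha + 1) beta x * h x) +
   m * (gamma_kernel (alpha + 1) beta x * dh x)))%R = 0 - l.
  apply: (@FTC_itv0y _ _ (fun x => gamma_kernel (alpha + 1) beta x * h x)) => //.
  - move=> x x0; apply: (is_derive_eq (is_deriveM (is_derive_gamma_kernel alpha beta x0) (dh' x))).
    by rewrite /GRing.scale/=; ring.
  - move=> x; rewrite in_itv/= andbT => x0.
    have cg (p : R) : {for x, continuous (gamma_kernel p beta)} by exact: continuous_gamma_kernel.
    apply: cvgD; last by apply: cvgMr; apply: cvgM; [exact: cg|exact: cdh].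
    by apply: cvgD; do ?apply: cvgMr; apply: cvgM; [exact: cg|exact: ch|exact: cg|exact: ch].
  - by apply: cvg_mul_bounded => //; apply: cvgy_gamma_kernel => //; rewrite lerDr.
move: F; rewrite E => F; apply/eqP; rewrite -subr_eq0; apply/eqP.
transitivity (0 - l + l); last by ring.
by rewrite -F; ring.
Qed.

Lemma cvg_expRM_at0 beta : expR (- (beta * x)) @[x --> 0^'+] --> (1 : R).
Proof.
apply: cvg_at_right_filter.
have : {for (0 : R), continuous (fun x => expR (- (beta * x)))}.
  apply: (@continuous_comp _ _ _ (fun x => - (beta * x)) expR); last exact: continuous_expR.
  by apply: cvgN; apply: cvgMr; exact: cvg_id.
by rewrite /prop_for /continuous_at mulr0 oppr0 expR0.
Qed.

Lemma gamma_kernel_at0 alpha beta : 0 < alpha ->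
  gamma_kernel (alpha + 1) beta x @[x --> 0^'+] --> (0 : R).
Proof.
move=> a0; rewrite /gamma_kernel addrK.
have := @cvgM _ _ _ _ _ _ _ _ (powR_cvg0 a0) (cvg_expRM_at0 beta).
by rewrite mul0r; exact.
Qed.

(** With Phi = [gamma_cos] + i [gamma_sin], this is the real part of alpha Phi_alpha = (beta - iu)
    Phi_(alpha+1); the next lemma is the imaginary part. *)
Lemma gamma_cosD1 alpha beta u : 0 < alpha -> 0 < beta ->
  alpha * gamma_cos alpha beta u =
  beta * gamma_cos (alpha + 1) beta u + u * gamma_sin (alpha + 1) beta u.
Proof.
move=> a0 b0.
have I := integrable_gamma_kernelM a0 b0 (measurable_cosM u) (fun x => norm_cos_le1 (u * x)).
have mD : measurable (`]0%R, +oo[%classic : set (measurableTypeR R)).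
  exact: measurable_itv.
have := @gamma_by_parts alpha beta (fun x => cos (u * x)) (fun x => sin (u * x)) 0 (- u)
  (ltW a0) b0.
move=> /(_ (integrable_scaler mD alpha I)).
rewrite RintegralZl// addr0 mulNr opprK; apply.
- by apply: cvg_mul_bounded; [move=> x; exact: norm_cos_le1|exact: gamma_kernel_at0].
- exact: is_derive_cosM.
- move=> x; apply/differentiable_continuous.
  by apply/derivable1_diffP; case: (is_derive_sinM u x).
- by move=> x; exact: norm_cos_le1.
- by move=> x; exact: norm_sin_le1.
Qed.

Lemma gamma_sinD1 alpha beta u : 0 < alpha -> 0 < beta ->
  alpha * gamma_sin alpha beta u =
  beta * gamma_sin (alpha + 1) beta u - u * gamma_cos (alpha + 1) beta u.
Proof.
move=> a0 b0.
have I := integrable_gamma_kernelM a0 b0 (measurable_sinM u) (fun x => norm_sin_le1 (u * x)).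
have mD : measurable (`]0%R, +oo[%classic : set (measurableTypeR R)).
  exact: measurable_itv.
have := @gamma_by_parts alpha beta (fun x => sin (u * x)) (fun x => cos (u * x)) 0 u
  (ltW a0) b0.
move=> /(_ (integrable_scaler mD alpha I)).
rewrite RintegralZl// addr0; apply.
- by apply: cvg_mul_bounded; [move=> x; exact: norm_sin_le1|exact: gamma_kernel_at0].
- exact: is_derive_sinM.
- move=> x; apply/differentiable_continuous.
  by apply/derivable1_diffP; case: (is_derive_cosM u x).
- by move=> x; exact: norm_sin_le1.
- by move=> x; exact: norm_cos_le1.
Qed.

(** The case alpha = 0 of integration by parts, with boundary values cos 0 = 1 and sin 0 = 0, is a
    linear system for the two transforms of determinant beta^2 + u^2 up to sign. *)
Lemma gamma_cos_sin1 beta u : 0 < beta ->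
  gamma_cos 1 beta u = beta / (beta ^+ 2 + u ^+ 2) /\
  gamma_sin 1 beta u = u / (beta ^+ 2 + u ^+ 2).
Proof.
move=> b0.
have mD : measurable (`]0%R, +oo[%classic : set (measurableTypeR R)).
  exact: measurable_itv.
have I0 (h : R -> R) : leb.-integrable `]0%R, +oo[
    (EFin \o (fun x => 0 * (gamma_kernel 0 beta x * h x))).
  rewrite (_ : _ \o _ = cst 0%E); first exact: integrable0.
  by apply/funext => x /=; rewrite mul0r.
have J0 (h : R -> R) : \int[leb]_(x in `]0%R, +oo[) (0 * (gamma_kernel 0 beta x * h x)) = 0.
  under eq_Rintegral do rewrite mul0r.
  by rewrite Rintegral_cst// mul0r.
have at0 (h : R -> R) : {for 0, continuous h} ->
    gamma_kernel (0 + 1) beta x * h x @[x --> 0^'+] --> h 0.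
  move=> ch; rewrite /gamma_kernel add0r subrr.
  have := @cvgM _ _ _ _ _ _ _ _ (cvg_expRM_at0 beta) (cvg_at_right_filter ch).
  rewrite mul1r => H; under eq_fun do rewrite powRr0 mul1r.
  exact: H.
have cs v (x : R) : {for x, continuous (fun x => cos (v * x))}.
  apply/differentiable_continuous.
  by apply/derivable1_diffP; case: (is_derive_cosM v x).
have sc v (x : R) : {for x, continuous (fun x => sin (v * x))}.
  apply/differentiable_continuous.
  by apply/derivable1_diffP; case: (is_derive_sinM v x).
have E1 := gamma_by_parts (lexx 0) b0 (I0 _) (at0 _ (cs u 0)) (is_derive_cosM u)
  (sc u) (fun x => norm_cos_le1 _) (fun x => norm_sin_le1 _).
have E2 := gamma_by_parts (lexx 0) b0 (I0 _) (at0 _ (sc u 0)) (is_derive_sinM u)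
  (cs u) (fun x => norm_sin_le1 _) (fun x => norm_cos_le1 _).
move: E1 E2; rewrite !J0 !add0r mulr0 cos0 sin0 mulNr opprK.
rewrite -/(gamma_cos 1 beta u) -/(gamma_sin 1 beta u) => E1 E2.
have q0 : beta ^+ 2 + u ^+ 2 != 0 by rewrite gt_eqF// ltr_pwDl ?sqr_ge0// exprn_gt0.
split; apply/eqP; rewrite eq_sym -subr_eq0; apply/eqP.
  transitivity ((beta * (1 - (beta * gamma_cos 1 beta u + u * gamma_sin 1 beta u))
    + u * (beta * gamma_sin 1 beta u - u * gamma_cos 1 beta u - 0)) / (beta ^+ 2 + u ^+ 2)).
    by field.
  by rewrite -E1 -E2 !subrr !mulr0 addr0 mul0r.
transitivity ((u * (1 - (beta * gamma_cos 1 beta u + u * gamma_sin 1 beta u))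
    - beta * (beta * gamma_sin 1 beta u - u * gamma_cos 1 beta u - 0)) / (beta ^+ 2 + u ^+ 2)).
  by field.
by rewrite -E1 -E2 !subrr !mulr0 subr0 mul0r.
Qed.

(** Differentiation in u brings down a factor x, which raises the shape by one, so the kernel of
    shape alpha + 1 dominates. The sign [eps] lets one proof cover both cosine and sine. *)
Lemma is_derive_gamma_integral alpha beta u (c s : R -> R) (eps : R) :
  0 < alpha -> 0 < beta -> measurable_fun [set: R] c -> measurable_fun [set: R] s ->
  (forall x, `|c x| <= 1) -> (forall x, `|s x| <= 1) -> `|eps| <= 1 ->
  (forall x, is_derive x (1 : R) c (eps * s x)) ->
  is_derive u (1 : R)
    (fun u => \int[leb]_(x in `]0%R, +oo[) (gamma_kernel alpha beta x * c (u * x)))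
    (eps * \int[leb]_(x in `]0%R, +oo[) (gamma_kernel (alpha + 1) beta x * s (u * x))).
Proof.
move=> a0 b0 mc ms c1 s1 eps1 dc.
have a1 : 0 < alpha + 1 by rewrite addr_gt0.
have mD : measurable (`]0%R, +oo[%classic : set (measurableTypeR R)).
  exact: measurable_itv.
have dk v x : is_derive v (1 : R) (fun u => gamma_kernel alpha beta x * c (u * x))
    (gamma_kernel alpha beta x * (eps * s (v * x) * x)).
  have d1 := is_deriveM (is_derive_id v (1 : R)) (is_derive_cst x v (1 : R)).
  have := is_deriveZ (gamma_kernel alpha beta x)
    (@is_derive1_comp _ c (fun u => u * x) v _ _ (dc _) d1).
  by rewrite /GRing.scale/= mulr0 add0r mulr1.
have Iu : (`]u - 1, u + 1[%classic : set R) u.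
  by rewrite /= in_itv/=; apply/andP; split; lra.
have intf (v : R) : (`]u - 1, u + 1[%classic : set R) v ->
    leb.-integrable `]0%R, +oo[ (EFin \o (fun x => gamma_kernel alpha beta x * c (v * x))).
  move=> _; apply: integrable_gamma_kernelM => //.
  by apply: measurableT_comp => //; exact: measurable_funM.
have p1E v x : partial1of2 (fun u x => gamma_kernel alpha beta x * c (u * x)) v x =
    gamma_kernel alpha beta x * (eps * s (v * x) * x).
  by rewrite partial1of2E; case: (dk v x).
have der (v : R) (y : measurableTypeR R) : (`]u - 1, u + 1[%classic : set R) v ->
    (`]0%R, +oo[%classic : set (measurableTypeR R)) y ->
    derivable (fun u => gamma_kernel alpha beta y * c (u * y)) v 1.
  by move=> _ _; case: (dk v y).
have ub (v : R) (y : measurableTypeR R) : (`]u - 1, u + 1[%classic : set R) v ->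
    (`]0%R, +oo[%classic : set (measurableTypeR R)) y ->
    `|partial1of2 (fun u x => gamma_kernel alpha beta x * c (u * x)) v y|
    <= gamma_kernel (alpha + 1) beta y.
  move=> _; rewrite /= in_itv/= andbT => y0; rewrite p1E gamma_kernelD1//.
  rewrite normrM ger0_norm ?gamma_kernel_ge0// mulrC ler_wpM2r ?gamma_kernel_ge0//.
  rewrite !normrM (gtr0_norm y0) ler_piMl ?(ltW y0)//.
  by rewrite mulr_ile1.
have H := @differentiation_under_integral R _ (measurableTypeR R) leb
  (fun u x => gamma_kernel alpha beta x * c (u * x)) _ mD u (u - 1) (u + 1) Iu
  intf der _ (fun y => gamma_kernel_ge0 (alpha + 1) beta y)
  (integrable_gamma_kernel a1 b0) ub.
have D := @derivable_under_integral R _ (measurableTypeR R) leb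
  (fun u x => gamma_kernel alpha beta x * c (u * x)) _ mD u (u - 1) (u + 1) Iu
  intf der _ (fun y => gamma_kernel_ge0 (alpha + 1) beta y)
  (integrable_gamma_kernel a1 b0) ub.
apply: DeriveDef; first exact: D.
rewrite -derive1E H -RintegralZl//; last first.
  apply: integrable_gamma_kernelM => //.
  by apply: measurableT_comp => //; exact: measurable_funM.
apply: eq_Rintegral => x; rewrite inE/= in_itv/= andbT => x0.
rewrite p1E gamma_kernelD1//; ring.
Qed.

Lemma is_derive_gamma_cos alpha beta u : 0 < alpha -> 0 < beta ->
  is_derive u (1 : R) (gamma_cos alpha beta) (- gamma_sin (alpha + 1) beta u).
Proof.
move=> a0 b0; rewrite -mulN1r.
apply: is_derive_gamma_integral => //.
- by apply: continuous_measurable_fun; exact: continuous_cos.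
- by apply: continuous_measurable_fun; exact: continuous_sin.
- by move=> x; exact: norm_cos_le1.
- by move=> x; exact: norm_sin_le1.
- by rewrite normrN1.
- by move=> x; rewrite mulN1r; exact: is_derive_cos.
Qed.

Lemma is_derive_gamma_sin alpha beta u : 0 < alpha -> 0 < beta ->
  is_derive u (1 : R) (gamma_sin alpha beta) (gamma_cos (alpha + 1) beta u).
Proof.
move=> a0 b0; rewrite -[X in is_derive _ _ _ X]mul1r.
apply: is_derive_gamma_integral => //.
- by apply: continuous_measurable_fun; exact: continuous_sin.
- by apply: continuous_measurable_fun; exact: continuous_cos.
- by move=> x; exact: norm_sin_le1.
- by move=> x; exact: norm_cos_le1.
- by rewrite normr1.
- by move=> x; rewrite mul1r; exact: is_derive_sin.
Qed.

(* The squared modulus of the Fourier integral solves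
   D' = - 2 alpha u / (beta^2 + u^2) D, so no complex power is needed. *)
Lemma gamma_modulus alpha beta u : 0 < alpha -> 0 < beta ->
  gamma_cos alpha beta u ^+ 2 + gamma_sin alpha beta u ^+ 2 =
  gamma_cos alpha beta 0 ^+ 2 * (beta ^+ 2 / (beta ^+ 2 + u ^+ 2)) `^ alpha.
Proof.
move=> a0 b0.
have q0 v : 0 < beta ^+ 2 + v ^+ 2 by rewrite ltr_pwDl ?sqr_ge0// exprn_gt0.
pose D v := (gamma_cos alpha beta v ^+ 2 + gamma_sin alpha beta v ^+ 2) *
  (beta ^+ 2 + v ^+ 2) `^ alpha.
have dD v : is_derive v (1 : R) D 0.
  have dq := is_deriveD (is_derive_cst (beta ^+ 2) v (1 : R))
    (is_deriveX 2 (is_derive_id v (1 : R))).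
  have dp := @is_derive1_comp _ (fun y => y `^ alpha) (fun v => beta ^+ 2 + v ^+ 2) v _ _
    (is_derive1_powR alpha (q0 v)) dq.
  have dc := is_deriveX 2 (is_derive_gamma_cos v a0 b0).
  have ds := is_deriveX 2 (is_derive_gamma_sin v a0 b0).
  apply: (is_derive_eq (is_deriveM (is_deriveD dc ds) dp)).
  rewrite /GRing.scale/= -(mulr_powRB1 (ltW (q0 v)) a0).
  have := gamma_cosD1 v a0 b0; have := gamma_sinD1 v a0 b0.
  set c := gamma_cos alpha beta v; set t := gamma_sin alpha beta v.
  set c1 := gamma_cos _ _ _; set t1 := gamma_sin _ _ _; set Q := _ `^ (alpha - 1).
  move=> E2 E1.
  have E3 : (beta * c1 + v * t1) * t = (beta * t1 - v * c1) * c.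
    by rewrite -E1 -E2; ring.
  rewrite -[(_ + _) v]/(c ^+ 2 + t ^+ 2).
  (* The derivative is a combination of the two recursions [E1] and [E2] and of [E3], obtained by
     eliminating alpha between them; each bracket is zero. *)
  transitivity (2 * Q * (v * c * (alpha * c - (beta * c1 + v * t1)) +
    v * t * (alpha * t - (beta * t1 - v * c1)) +
    beta * ((beta * c1 + v * t1) * t - (beta * t1 - v * c1) * c))); first by ring.
  by rewrite E1 E2 E3 !subrr !mulr0 !addr0 mulr0.
have : D u = D 0 by apply: is_derive_0_is_cst.
have s0 : gamma_sin alpha beta 0 = 0.
  rewrite /gamma_sin; under eq_Rintegral do rewrite mul0r sin0 mulr0.
  by rewrite Rintegral_cst ?mul0r//; exact: measurable_itv.
rewrite /D s0 !expr0n/= !addr0 => H.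
apply: (@mulIf _ ((beta ^+ 2 + u ^+ 2) `^ alpha)).
  by rewrite gt_eqF// powR_gt0.
rewrite H -[RHS]mulrA -powRM ?(ltW (q0 u))// ?divr_ge0 ?(ltW (q0 u)) ?sqr_ge0//.
by rewrite divfK// gt_eqF.
Qed.

End GammaKernel.

(** * Fourier transform of fbar *)

(** Matchbox at x = w/(2b), y = v/(2b): here b^2/(wv) = 1/(4xy), and multiplying x^j y^(n+1) by the
    (n+1)-st power of this leaves a power of b/w. In the application w = b - iu and v = b + iu. *)
Lemma matchbox_partial_fractions (F : fieldType) (b w v : F) n :
  2 != 0 :> F -> b != 0 -> w != 0 -> v != 0 -> w + v = 2 * b ->
  \sum_(j < n.+1) 'C(n + j, j)%:R / 2 ^+ (n.+1 + j) *
    (b ^+ (n - j).+1 * (w^-1 ^+ (n - j).+1 + v^-1 ^+ (n - j).+1)) =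
  (b ^+ 2 / (w * v)) ^+ n.+1.
Proof.
move=> two0 b0 w0 v0 wv.
have xy : w / (2 * b) + v / (2 * b) = 1.
  by rewrite -mulrDl wv divff// mulf_neq0.
transitivity ((b ^+ 2 / (w * v)) ^+ n.+1 * \sum_(j < n.+1) 'C(n + j, j)%:R *
    ((w / (2 * b)) ^+ j * (v / (2 * b)) ^+ n.+1 +
     (v / (2 * b)) ^+ j * (w / (2 * b)) ^+ n.+1)); last first.
  by rewrite (matchbox_identity n xy) mulr1.
rewrite mulr_sumr.
apply: eq_bigr => j _.
have jn : (j <= n)%N by rewrite -ltnS.
have E (p q : F) : p != 0 -> q != 0 ->
    b ^+ (n - j).+1 * p^-1 ^+ (n - j).+1 =
    2 ^+ (n.+1 + j) * ((b ^+ 2 / (p * q)) ^+ n.+1 * ((p / (2 * b)) ^+ j * (q / (2 * b)) ^+ n.+1)).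
  move=> p0 q0.
  have -> : 2 ^+ (n.+1 + j) * ((b ^+ 2 / (p * q)) ^+ n.+1 *
      ((p / (2 * b)) ^+ j * (q / (2 * b)) ^+ n.+1)) =
      (b / p) ^+ n.+1 * (p / b) ^+ j.
    rewrite exprD [RHS]mulrC -[in RHS](_ : 2 * (p / (2 * b)) = p / b); last first.
      by field; rewrite two0 b0.
    rewrite -[in RHS](_ : 2 * (b ^+ 2 / (p * q) * (q / (2 * b))) = b / p); last first.
      by field; rewrite two0 b0 p0 q0.
    rewrite ![(2 * _) ^+ _]exprMn ![(_ * (q / _)) ^+ _]exprMn.
    ring.
  have -> : (b / p) ^+ n.+1 = (b / p) ^+ (n - j).+1 * (b / p) ^+ j.
    by rewrite -exprD addSn subnK.
  by rewrite -mulrA -!exprMn mulrA divfK// divff// expr1n mulr1.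
rewrite mulrDr (E w v)// (E v w)// [v * w]mulrC; field.
by rewrite expf_neq0.
Qed.

Lemma integrable_sum_nat d (T : measurableType d) (R : realType)
    (mu : {measure set T -> \bar R}) (D : set T) (mD : measurable D) m (F : nat -> T -> R) :
  (forall i, mu.-integrable D (EFin \o F i)) ->
  mu.-integrable D (EFin \o (fun x => \sum_(0 <= i < m) F i x)) /\
  (\int[mu]_(x in D) \sum_(0 <= i < m) F i x)%R = \sum_(0 <= i < m) (\int[mu]_(x in D) F i x)%R.
Proof.
move=> IF; elim: m => [|m [IH1 IH2]].
  split.
    rewrite (_ : _ \o _ = cst 0%E); first exact: integrable0.
    by apply/funext => x /=; rewrite big_nil.
  by under eq_Rintegral do rewrite big_nil; rewrite big_nil Rintegral_cst ?mul0r.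
split.
  rewrite (_ : _ \o _ = EFin \o (fun x => \sum_(0 <= i < m) F i x + F m x)).
    exact: integrable_addr.
  by apply/funext => x /=; rewrite big_nat_recr.
under eq_Rintegral do rewrite big_nat_recr//=.
by rewrite RintegralD// IH2 big_nat_recr.
Qed.

Section FourierFbar.
Context {R : realType}.
Local Notation leb := (@lebesgue_measure R).
Implicit Types (b u x : R) (n m : nat).

(** The components of [fbar] have integer shapes, so ordinary powers of b - iu are enough, and the
    two real recursions become one division by b - iu. *)
Lemma gamma_complex m b u : 0 < b ->
  (gamma_cos m.+1%:R b u +i* gamma_sin m.+1%:R b u)%C =
  m`!%:R * (b +i* - u)%C^-1 ^+ m.+1.
Proof.
move=> b0.
have w0 : (b +i* - u)%C != 0 by rewrite eq_complex /= gt_eqF.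
elim: m => [|m IH].
  have [-> ->] := gamma_cos_sin1 u b0.
  rewrite fact0 mul1r expr1; apply: (@mulIf _ _ w0); rewrite mulVf//.
  have q0 : b ^+ 2 + u ^+ 2 != 0 by rewrite gt_eqF// ltr_pwDl ?sqr_ge0// exprn_gt0.
  by apply/eqP; rewrite eq_complex; simpc; apply/andP; split; apply/eqP => /=; field.
apply: (@mulIf _ _ w0).
transitivity (m.+1%:R * (gamma_cos m.+1%:R b u +i* gamma_sin m.+1%:R b u)%C); last first.
  by rewrite IH factS natrM [in RHS]exprSr !mulrA divfK.
have m0 : 0 < m.+1%:R :> R by rewrite ltr0n.
have E1 := gamma_cosD1 u m0 b0; have E2 := gamma_sinD1 u m0 b0.
rewrite -[m.+2%:R]natr1.
rewrite (_ : m.+1%:R = (m.+1%:R : R)%:C%C :> R[i]); last by rewrite rmorph_nat.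
by apply/eqP; rewrite eq_complex; simpc; apply/andP; split; apply/eqP => /=;
  rewrite ?E1 ?E2; ring.
Qed.

(** Stated without a parity assumption, to serve both the even cosine integrands and the odd sine
    integrands. *)
Lemma Rintegral_fold (f : R -> R) : measurable_fun [set: R] f ->
  leb.-integrable `]0%R, +oo[ (EFin \o f) ->
  leb.-integrable `]0%R, +oo[ (EFin \o (fun x => f (- x))) ->
  leb.-integrable [set: measurableTypeR R] (EFin \o f) /\
  (\int[leb]_x f x)%R =
  (\int[leb]_(x in `]0%R, +oo[) f x)%R + (\int[leb]_(x in `]0%R, +oo[) f (- x))%R.
Proof.
move=> mf If Ifn.
pose neg : set (measurableTypeR R) := `]-oo, 0%R[%classic.
pose nneg : set (measurableTypeR R) := `[0%R, +oo[%classic.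
have mneg : measurable neg by exact: measurable_itv.
have mnneg : measurable nneg by exact: measurable_itv.
have mfE : measurable_fun [set: measurableTypeR R] (EFin \o f) by exact/measurable_EFinP.
have negE : (-%R : measurableTypeR R -> measurableTypeR R) @^-1` neg = `]0%R, +oo[%classic.
  by apply/seteqP; split => x; rewrite /neg/= !in_itv/= oppr_lt0 ?andbT.
have mopp : measurable_fun [set: measurableTypeR R] (-%R : measurableTypeR R -> measurableTypeR R).
  exact: oppr_measurable.
(* Lebesgue measure is its own image under x -> -x, which converts integrals over the negative half
   line. *)
have pushE (g : measurableTypeR R -> \bar R) :
    (\int[leb]_(x in neg) g x = \int[pushforward leb (-%R : measurableTypeR R -> measurableTypeR R)]_(x in neg) g x)%E.
  by apply: eq_measure_integral => A mA _; exact/esym/lebesgue_measureN.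
have Ifn' : leb.-integrable ((-%R : measurableTypeR R -> measurableTypeR R) @^-1` neg)
    ((EFin \o f) \o (-%R : measurableTypeR R -> measurableTypeR R)).
  by rewrite negE.
have Ineg : leb.-integrable neg (EFin \o f).
  apply/integrableP; split; first exact: measurable_funTS.
  have /integrableP[_] := integrable_pushforward mopp mfE Ifn' mneg.
  by rewrite pushE.
have Inneg : leb.-integrable nneg (EFin \o f).
  apply/integrableP; split; first exact: measurable_funTS.
  rewrite -integral_itv_obnd_cbnd; first by case/integrableP: If.
  by apply: measurable_funTS; exact: measurableT_comp.
have TE : [set: measurableTypeR R] = neg `|` nneg.
  apply/seteqP; split => // x _; rewrite /neg /nneg /= !in_itv/= andbT.
  by case: (ltP x 0) => h; [left|right].
have disj : [disjoint neg & nneg].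
  apply/disj_setPS => x []; rewrite /neg /nneg /= !in_itv/= andbT => h1 h2.
  by move: (lt_le_trans h1 h2); rewrite ltxx.
have I : leb.-integrable [set: measurableTypeR R] (EFin \o f).
  apply/integrableP; split => //.
  rewrite TE ge0_integral_setU//; last by rewrite -TE; exact: measurableT_comp mfE.
  by apply: lte_add_pinfty; [case/integrableP: Ineg|case/integrableP: Inneg].
split => //; rewrite TE Rintegral_setU//; last by rewrite -TE.
rewrite addrC; congr (_ + _); first by rewrite Rintegral_itv_obnd_cbnd.
rewrite /Rintegral pushE (integral_pushforward mopp mfE Ifn' mneg) negE.
by [].
Qed.

Lemma fbar_gamma_kernel n b x : b != 0 -> 0 < x -> fbar n.+1 b x =
  \sum_(0 <= j < n.+1) 'C(n + j, j)%:R / 2 ^+ (n.+1 + j) *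
    (b ^+ (n - j).+1 / (n - j)`!%:R) * gamma_kernel (n - j).+1%:R b x.
Proof.
move=> b0 x0; rewrite fbarE//; last by rewrite gt_eqF.
rewrite big_mkord; apply: eq_bigr => j _.
rewrite -[RHS]mulrA; congr (_ * _).
rewrite /gamma_kernel gtr0_norm// -[_.+1%:R]natr1 addrK powR_mulrn ?(ltW x0)//.
rewrite exprMn exprS; ring.
Qed.

Lemma integrable_fbarM n b (h : R -> R) : 0 < b -> measurable_fun [set: R] h ->
  (forall x, `|h x| <= 1) ->
  leb.-integrable `]0%R, +oo[ (EFin \o (fun x => fbar n.+1 b x * h x)) /\
  (\int[leb]_(x in `]0%R, +oo[) (fbar n.+1 b x * h x))%R =
  \sum_(0 <= j < n.+1) 'C(n + j, j)%:R / 2 ^+ (n.+1 + j) *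
    (b ^+ (n - j).+1 / (n - j)`!%:R) *
    (\int[leb]_(x in `]0%R, +oo[) (gamma_kernel (n - j).+1%:R b x * h x)).
Proof.
move=> b0 mh h1.
have mD : measurable (`]0%R, +oo[%classic : set (measurableTypeR R)).
  exact: measurable_itv.
have Ik j : leb.-integrable `]0%R, +oo[
    (EFin \o (fun x => gamma_kernel (n - j).+1%:R b x * h x)).
  by apply: integrable_gamma_kernelM => //; rewrite ltr0n.
have [I E] := @integrable_sum_nat _ (measurableTypeR R) R leb _ mD n.+1 _
  (fun j => integrable_scaler mD ('C(n + j, j)%:R / 2 ^+ (n.+1 + j) *
    (b ^+ (n - j).+1 / (n - j)`!%:R)) (Ik j)).
have fE x : (`]0%R, +oo[%classic : set (measurableTypeR R)) x ->
   \sum_(0 <= j < n.+1) 'C(n + j, j)%:R / 2 ^+ (n.+1 + j) *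
    (b ^+ (n - j).+1 / (n - j)`!%:R) * (gamma_kernel (n - j).+1%:R b x * h x) =
   fbar n.+1 b x * h x.
  rewrite /= in_itv/= andbT => x0; rewrite fbar_gamma_kernel ?gt_eqF// mulr_suml.
  by apply: eq_bigr => j _; rewrite !mulrA.
split.
  apply: eq_integrable I => //.
  by move=> x /[!inE] Dx; rewrite /= fE.
transitivity (\int[leb]_(x in `]0%R, +oo[) \sum_(0 <= j < n.+1) 'C(n + j, j)%:R / 2 ^+ (n.+1 + j) *
    (b ^+ (n - j).+1 / (n - j)`!%:R) * (gamma_kernel (n - j).+1%:R b x * h x))%R.
  by apply: eq_Rintegral => x /[!inE] Dx; rewrite fE.
by rewrite E; apply: eq_bigr => j _; rewrite RintegralZl.
Qed.

Lemma fbarN n b x : fbar n b (- x) = fbar n b x.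
Proof. by rewrite /fbar normrN. Qed.

Lemma conjc_natM_invX (z : R[i]) m k :
  conjc (m%:R * z^-1 ^+ k) = m%:R * (conjc z)^-1 ^+ k.
Proof. by rewrite rmorphM rmorph_nat rmorphXn /= conjc_inv. Qed.

Lemma Re_natM_invX (c s : R) (z zc : R[i]) m k :
  (c +i* s)%C = m%:R * z^-1 ^+ k -> conjc z = zc ->
  (c%:C + c%:C)%C = m%:R * (z^-1 ^+ k + zc^-1 ^+ k).
Proof.
move=> G <-; rewrite mulrDr -conjc_natM_invX -G.
by apply/eqP; rewrite eq_complex /= subrr addr0 !eqxx.
Qed.

(** Doubling a cosine transform adds the complex transform to its conjugate, so powers of 1/(b - iu)
    and 1/(b + iu) appear in pairs, as in the partial fraction decomposition. *)
Lemma half_fbar_cos n b u : 0 < b ->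
  (\int[leb]_(x in `]0%R, +oo[) (fbar n.+1 b x * cos (u * x)))%R *+ 2 =
  (b ^+ 2 / (b ^+ 2 + u ^+ 2)) ^+ n.+1.
Proof.
move=> b0.
have -> : (\int[leb]_(x in `]0%R, +oo[) (fbar n.+1 b x * cos (u * x)))%R =
    \sum_(j < n.+1) 'C(n + j, j)%:R / 2 ^+ (n.+1 + j) *
    (b ^+ (n - j).+1 / (n - j)`!%:R * gamma_cos (n - j).+1%:R b u).
  rewrite (integrable_fbarM n b0 (measurable_cosM u) (fun x => norm_cos_le1 _)).2.
  by rewrite big_mkord; apply: eq_bigr => j _; rewrite -!mulrA.
have w0 : (b +i* - u)%C != 0 by rewrite eq_complex /= gt_eqF.
have v0 : (b +i* u)%C != 0 by rewrite eq_complex /= gt_eqF.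
have cw : conjc (b +i* - u)%C = (b +i* u)%C :> R[i] by rewrite /conjc opprK.
have bc0 : (b%:C)%C != 0 by rewrite eq_complex /= gt_eqF.
have wv : (b +i* - u)%C + (b +i* u)%C = 2 * b%:C%C.
  by rewrite mulr_natl mulr2n; simpc; rewrite addNr.
apply: (@complexI R); rewrite rmorphXn/=.
have := @matchbox_partial_fractions R[i] _ _ _ n _ bc0 w0 v0 wv.
rewrite (_ : ((b ^+ 2 / (b ^+ 2 + u ^+ 2))%:C)%C =
   (b%:C%C ^+ 2 / ((b +i* - u) * (b +i* u)))%C); last first.
  rewrite fmorph_div/= rmorphXn/=; congr (_ / _).
  by simpc; apply/eqP; rewrite eq_complex /=; apply/andP; split; apply/eqP; ring.
rewrite pnatr_eq0 => /(_ isT) <-; rewrite rmorphMn/= rmorph_sum/= -sumrMnl; apply: eq_bigr => j _.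
have G := gamma_complex (n - j) u b0.
have {}G := Re_natM_invX G cw.
rewrite -rmorphMn/= rmorphMn/= mulr2n.
rewrite !rmorphM/= !fmorphV/= !rmorphXn/= !rmorph_nat.
rewrite -!mulrDr; congr (_ * _); rewrite -mulrA; congr (_ * _).
by rewrite G mulKf// pnatr_eq0 -lt0n fact_gt0.
Qed.

Lemma fbar_cos n b u : 0 < b ->
  (\int[leb]_x (fbar n.+1 b x * cos (u * x)))%R =
  (b ^+ 2 / (b ^+ 2 + u ^+ 2)) ^+ n.+1.
Proof.
move=> b0.
have [I _] := integrable_fbarM n b0 (measurable_cosM u) (fun x => norm_cos_le1 _).
have E : (fun x => fbar n.+1 b (- x) * cos (u * - x)) = (fun x => fbar n.+1 b x * cos (u * x)).
  by apply/funext => x; rewrite fbarN mulrN cosN.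
have [||_ ->] := @Rintegral_fold (fun x => fbar n.+1 b x * cos (u * x)) _ I.
- by apply: measurable_funM; [exact: measurable_fbar|exact: measurable_cosM].
- by rewrite E.
- by rewrite E -mulr2n half_fbar_cos.
Qed.

Lemma fbar_sin n b u : 0 < b -> (\int[leb]_x (fbar n.+1 b x * sin (u * x)))%R = 0.
Proof.
move=> b0.
have [I _] := integrable_fbarM n b0 (measurable_sinM u) (fun x => norm_sin_le1 _).
have E : (fun x => fbar n.+1 b (- x) * sin (u * - x)) =
    (fun x => -1 * (fbar n.+1 b x * sin (u * x))).
  by apply/funext => x; rewrite fbarN mulrN sinN mulrN mulN1r.
have mD : measurable (`]0%R, +oo[%classic : set (measurableTypeR R)).
  exact: measurable_itv.
have [||_ ->] := @Rintegral_fold (fun x => fbar n.+1 b x * sin (u * x)) _ I.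
- by apply: measurable_funM; [exact: measurable_fbar|exact: measurable_sinM].
- by rewrite E; exact: integrable_scaler.
- by rewrite E RintegralZl// mulN1r subrr.
Qed.

Lemma integrable_fbar n b : 0 < b ->
  leb.-integrable [set: measurableTypeR R] (EFin \o fbar n.+1 b).
Proof.
move=> b0.
have [] := integrable_fbarM n b0 (measurable_cosM 0) (fun x => norm_cos_le1 _).
have -> : (fun x => fbar n.+1 b x * cos (0 * x)) = fbar n.+1 b.
  by apply/funext => x; rewrite mul0r cos0 mulr1.
move=> I _.
have [||//] := @Rintegral_fold (fbar n.+1 b) _ I; first exact: measurable_fbar.
by rewrite (_ : (fun x => _) = fbar n.+1 b)//; apply/funext => x; rewrite fbarN.
Qed.

End FourierFbar.

(** * Uniqueness of characteristic functions *)

Lemma integrable_bounded d (T : measurableType d) (R : realType)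
    (mu : {finite_measure set T -> \bar R}) (h : T -> R) (M : R) :
  measurable_fun [set: T] h -> (forall x, `|h x| <= M) ->
  mu.-integrable [set: T] (EFin \o h).
Proof.
move=> mh hM.
apply: (le_integrable _ _ _ (finite_measure_integrable_cst mu M measurableT)) => //.
  exact/measurable_EFinP.
by move=> x _; rewrite /= lee_fin (le_trans (hM x))// ler_norm.
Qed.

Section CharfunUnique.
Context {R : realType}.
Local Notation leb := (@lebesgue_measure R).
Local Notation rT := (measurableTypeR R).
Implicit Types (mu nu : {finite_measure set rT -> \bar R}) (a c e t u x y : R).

Lemma integrable_cosM mu u : mu.-integrable [set: rT] (EFin \o (fun x => cos (u * x))).
Proof.
by apply: (@integrable_bounded _ _ _ _ _ 1); [exact: measurable_cosM|move=> x; exact: norm_cos_le1].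
Qed.

Lemma integrable_sinM mu u : mu.-integrable [set: rT] (EFin \o (fun x => sin (u * x))).
Proof.
by apply: (@integrable_bounded _ _ _ _ _ 1); [exact: measurable_sinM|move=> x; exact: norm_sin_le1].
Qed.

(** The addition formula isolates y, so the law enters only through its characteristic function at
    u. *)
Lemma Rintegral_cosB mu u y :
  (\int[mu]_x cos ((x - y) * u))%R =
  cos (y * u) * (\int[mu]_x cos (u * x))%R + sin (y * u) * (\int[mu]_x sin (u * x))%R.
Proof.
have Ic := integrable_scaler measurableT (cos (y * u)) (integrable_cosM mu u).
have Is := integrable_scaler measurableT (sin (y * u)) (integrable_sinM mu u).
rewrite -RintegralZl ?integrable_cosM// -RintegralZl ?integrable_sinM// -RintegralD//.
apply: eq_Rintegral => x _; rewrite mulrBl cosB [x * u]mulrC; ring.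
Qed.

Definition cauchy_kernel e x := e / (e ^+ 2 + x ^+ 2).

Lemma cauchy_kernel_ge0 e x : 0 <= e -> 0 <= cauchy_kernel e x.
Proof. by move=> e0; rewrite divr_ge0// addr_ge0 ?sqr_ge0. Qed.

(* The Cauchy kernel is the Laplace transform of a cosine, so its integral against
   a law depends on the characteristic function only. *)
Lemma integral_cauchy_kernel mu e y : 0 < e ->
  (\int[mu]_x (cauchy_kernel e (x - y))%:E)%E =
  (\int[leb]_(t in `]0%R, +oo[)
     (gamma_kernel 1 e t * \int[mu]_x cos ((x - y) * t))%:E)%E.
Proof.
move=> e0.
have mD : measurable (`]0%R, +oo[%classic : set rT) by exact: measurable_itv.
(* Extension by zero allows Fubini on the whole product space. *)
pose h := gamma_kernel 1 e \_ (`]0%R, +oo[%classic : set R).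
have h0 t : 0 <= h t.
  by rewrite /h patchE; case: ifPn => // _; exact: gamma_kernel_ge0.
have mh : measurable_fun [set: rT] h.
  apply/(measurable_restrictT _ mD); apply: measurable_funTS.
  exact: measurable_gamma_kernel.
have hM (w : R -> R) t : (h t * w t)%:E =
    (((fun t => (gamma_kernel 1 e t * w t)%:E) \_ (`]0%R, +oo[%classic : set rT)) t).
  by rewrite /h !patchE; case: ifPn => // _; rewrite mul0r.
pose f (z : rT * rT) := (h z.2 * cos ((z.1 - y) * z.2))%:E.
have mf : measurable_fun [set: rT * rT] f.
  apply/measurable_EFinP; apply: measurable_funM.
    exact: measurableT_comp mh measurable_snd.
  apply: (measurableT_comp (continuous_measurable_fun (@continuous_cos R))).
  by apply: measurable_funM => //; apply: measurable_funB.
have Ih : (\int[leb]_t (h t)%:E < +oo)%E.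
  have /integrableP[_] := integrable_gamma_kernel (@ltr01 R) e0.
  rewrite [in X in (X < _)%E]integral_mkcond; congr (_ < _)%E.
  apply: eq_integral => t _; rewrite /h !patchE; case: ifPn => //= _.
  by rewrite ger0_norm// gamma_kernel_ge0.
have If : (mu \x leb)%E.-integrable [set: rT * rT] f.
  apply/(integrable12ltyP _ _ mf).
  apply: (@le_lt_trans _ _ (\int[mu]_x (\int[leb]_t (h t)%:E))%E).
    apply: ge0_le_integral => //.
    - by move=> x _; apply: integral_ge0.
    - have mabs : measurable_fun [set: rT * rT] (abse \o f) by exact: measurableT_comp.
      apply: (@measurable_fun_fubini_tonelli_F _ _ rT rT R leb (abse \o f)) => // z.
      exact: abse_ge0.
    - move=> x _; apply: ge0_le_integral => //.
      + by apply: measurableT_comp => //; exact: measurableT_comp mf (measurable_pair1 x).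
      + by apply/measurable_EFinP.
      + by move=> t _; rewrite /f/= lee_fin normrM (ger0_norm (h0 t)) ler_piMr// norm_cos_le1.
  rewrite integral_cst// lte_mul_pinfty//.
  - by apply: integral_ge0 => t _; rewrite lee_fin.
  - rewrite ge0_fin_numE//; apply: integral_ge0 => t _; rewrite lee_fin//.
  - by rewrite -ge0_fin_numE// fin_num_measure.
transitivity (\int[mu]_x \int[leb]_t f (x, t))%E.
  apply: eq_integral => x _; rewrite /f/=.
  under [RHS]eq_integral do rewrite (hM (fun t => cos ((x - y) * t))).
  rewrite -integral_mkcond.
  have I := integrable_gamma_kernelM (@ltr01 R) e0 (measurable_cosM (x - y))
    (fun t => norm_cos_le1 _).
  rewrite -[RHS]fineK; last exact: integrable_fin_num.
  by congr EFin; rewrite -[RHS]/(gamma_cos 1 e (x - y)) (gamma_cos_sin1 _ e0).1.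
rewrite Fubini// [RHS]integral_mkcond; apply: eq_integral => t _.
rewrite -hM /f/=.
have Ic : mu.-integrable [set: rT] (EFin \o (fun x => cos ((x - y) * t))).
  apply: (@integrable_bounded _ _ _ _ _ 1); last by move=> x; exact: norm_cos_le1.
  apply: (measurableT_comp (continuous_measurable_fun (@continuous_cos R))).
  by apply: measurable_funM => //; apply: measurable_funB.
under eq_integral do rewrite EFinM.
rewrite integralZl// EFinM; congr (_ * _)%E.
by rewrite /Rintegral fineK//; exact: integrable_fin_num.
Qed.

Lemma integral_cauchy_itv e c d x : 0 < e -> c < d ->
  (\int[leb]_(y in `[c, d]) (cauchy_kernel e (x - y))%:E)%E =
  (atan ((d - x) / e) - atan ((c - x) / e))%:E.
Proof.
move=> e0 cd.
have q0 y : 0 < e ^+ 2 + (x - y) ^+ 2 by rewrite ltr_pwDl ?sqr_ge0// exprn_gt0.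
have dF y : is_derive y (1 : R) (fun y => atan ((y - x) / e)) (cauchy_kernel e (x - y)).
  have d1 := is_deriveZ e^-1 (is_deriveB (is_derive_id y (1 : R)) (is_derive_cst x y (1 : R))).
  have E : (fun y => atan ((y - x) / e)) = atan \o (e^-1 \*: (id - cst x)).
    by apply/funext => z /=; rewrite mulrC.
  rewrite E; apply: (is_derive_eq (@is_derive1_comp _ atan _ y _ _ (is_derive1_atan _) d1)).
  rewrite /cauchy_kernel /GRing.scale/= subr0 mulr1.
  rewrite -[e^-1 *: _]/(e^-1 * (y - x)).
  have := q0 y; rewrite (_ : (x - y) ^+ 2 = (y - x) ^+ 2); last by rewrite -sqrrN opprB.
  move=> q1; field.
  by rewrite !gt_eqF.
have cF y : {for y, continuous (fun y => atan ((y - x) / e))}.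
  by apply/differentiable_continuous/derivable1_diffP; case: (dF y).
rewrite EFinB; apply: (@continuous_FTC2 _ _ (fun y => atan ((y - x) / e))) => //.
- apply: continuous_subspaceT => y.
  apply: cvgM; first exact: cvg_cst.
  apply: cvgV; first by rewrite gt_eqF.
  apply: cvgD; first exact: cvg_cst.
  apply: (@continuous_comp _ _ _ (fun y => x - y) (fun z => z ^+ 2)).
    by apply: cvgB; [exact: cvg_cst|exact: cvg_id].
  exact: exprn_continuous.
- split.
  + by move=> y _; case: (dF y).
  + by apply: cvg_at_right_filter; exact: cF.
  + by apply: cvg_at_left_filter; exact: cF.
- by move=> y _; rewrite derive1E; case: (dF y).
Qed.

(** By Tonelli, the smoothed law of [c, d] is the integral of a bounded arctangent difference
    against the law itself, the form in which the width can tend to 0. *)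
Lemma integral_atan mu e c d : 0 < e -> c < d ->
  (\int[leb]_(y in `[c, d]) \int[mu]_x (cauchy_kernel e (x - y))%:E)%E =
  (\int[mu]_x (atan ((d - x) / e) - atan ((c - x) / e))%:E)%E.
Proof.
move=> e0 cd.
have mD : measurable (`[c, d]%classic : set rT) by exact: measurable_itv.
pose f (z : rT * rT) := (\1_(`[c, d]%classic : set rT) z.1 * cauchy_kernel e (z.2 - z.1))%:E.
have f0 z : (0 <= f z)%E by rewrite lee_fin mulr_ge0// cauchy_kernel_ge0// ltW.
have mf : measurable_fun [set: rT * rT] f.
  apply/measurable_EFinP; apply: measurable_funM.
    exact: measurableT_comp (measurable_indic mD) measurable_fst.
  apply: (@measurableT_comp _ _ _ _ _ _ (cauchy_kernel e)).
    apply: continuous_measurable_fun => x.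
    apply: cvgM; first exact: cvg_cst.
    apply: cvgV; first by rewrite gt_eqF// ltr_pwDl ?sqr_ge0// exprn_gt0.
    by apply: cvgD; [exact: cvg_cst|exact: exprn_continuous].
  by apply: measurable_funB.
have E1 : (\int[leb]_y \int[mu]_x f (y, x))%E =
    (\int[leb]_(y in `[c, d]) \int[mu]_x (cauchy_kernel e (x - y))%:E)%E.
  rewrite [RHS]integral_mkcond; apply: eq_integral => y _; rewrite patchE /f/= indicE.
  case: ifPn => yD; first by under eq_integral do rewrite mul1r.
  by under eq_integral do rewrite mul0r; rewrite integral0.
have E2 : (\int[mu]_x \int[leb]_y f (y, x))%E =
    (\int[mu]_x (atan ((d - x) / e) - atan ((c - x) / e))%:E)%E.
  apply: eq_integral => x _; rewrite -integral_cauchy_itv// [RHS]integral_mkcond.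
  apply: eq_integral => y _; rewrite patchE /f/= indicE.
  by case: ifPn => yD; rewrite ?mul1r ?mul0r.
by rewrite -E1 -E2; exact: fubini_tonelli.
Qed.

Lemma cvg_atan_step a :
  atan (a * n.+1%:R ^+ 2 + n.+1%:R) @[n --> \oo] --> (if 0 <= a then pi / 2 else - (pi / 2) : R).
Proof.
have cN : n.+1%:R @[n --> \oo] --> (+oo : set_system R).
  by have := @cvgr_idn R; rewrite -cvg_shiftS.
case: ifPn => a0.
  apply: (@cvg_comp _ _ _ (fun n => a * n.+1%:R ^+ 2 + n.+1%:R) atan _ (pinfty_nbhs R)); last exact: cvgy_atan.
  apply/cvgryPge => A; near=> n.
  apply: (@le_trans _ _ n.+1%:R).
    by near: n; move: A; exact/cvgryPge.
  by rewrite lerDr mulr_ge0// sqr_ge0.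
rewrite -ltNge in a0.
under eq_fun do rewrite -[_ + _]opprK atanN.
apply: cvgN.
apply: (@cvg_comp _ _ _ (fun n => - (a * n.+1%:R ^+ 2 + n.+1%:R)) atan _ (pinfty_nbhs R)); last exact: cvgy_atan.
apply/cvgryPge => A; near=> n.
apply: (@le_trans _ _ n.+1%:R).
  by near: n; move: A; exact/cvgryPge.
(* For a < 0 and m = n + 1 beyond this threshold, the quadratic term wins: -(a m^2 + m) >= m. *)
have h : - 2 / a <= n.+1%:R by near: n; move: (- 2 / a); exact/cvgryPge.
rewrite -subr_ge0 (_ : _ - _ = (- a * n.+1%:R - 2) * n.+1%:R); last by ring.
rewrite mulr_ge0// subr_ge0.
by move: h; rewrite ler_ndivrMr// mulNr [a * _]mulrC; lra.
Unshelve. all: by end_near. Qed.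

(* Integrating the Cauchy kernel of width 1/n^2 over [c + 1/n, d + 1/n] gives a
   bounded function of x that tends to pi on ]c, d] and to 0 elsewhere; because of the
   shift 1/n the end points belong to the half-open interval in the limit, so atoms
   there do no harm. *)
Lemma charfun_unique mu nu : (forall u, charfun mu u = charfun nu u) ->
  forall A, measurable A -> mu A = nu A.
Proof.
move=> mn.
have munu e c d : 0 < e -> c < d ->
    (\int[mu]_x (atan ((d - x) / e) - atan ((c - x) / e))%:E)%E =
    (\int[nu]_x (atan ((d - x) / e) - atan ((c - x) / e))%:E)%E.
  move=> e0 cd; rewrite -!integral_atan//; apply: eq_integral => y _.
  rewrite !integral_cauchy_kernel//; apply: eq_integral => t _.
  rewrite !Rintegral_cosB.
  have [Ec Es] := mn t.
  by rewrite /Rintegral Ec Es.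
pose N n : R := n.+1%:R.
pose G c d n (x : rT) : R := atan ((d - x) * N n ^+ 2 + N n) - atan ((c - x) * N n ^+ 2 + N n).
have mG c d n : measurable_fun [set: rT] (G c d n).
  have ma a : measurable_fun [set: rT] (fun x : rT => atan ((a - x) * N n ^+ 2 + N n)).
    apply: (measurableT_comp (continuous_measurable_fun (@continuous_atan R))).
    by apply: measurable_funD => //; apply: measurable_funM => //; apply: measurable_funB.
  exact: measurable_funB.
have bG c d n x : `|G c d n x| <= pi.
  have := atan_gtNpi2 ((d - x) * N n ^+ 2 + N n).
  have := atan_ltpi2 ((d - x) * N n ^+ 2 + N n).
  have := atan_gtNpi2 ((c - x) * N n ^+ 2 + N n).
  have := atan_ltpi2 ((c - x) * N n ^+ 2 + N n).
  by rewrite /G ler_norml => h1 h2 h3 h4; apply/andP; split; lra.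
have GE c d n : c < d -> (\int[mu]_x G c d n x)%R = (\int[nu]_x G c d n x)%R.
  move=> cd; have N0 : 0 < N n by rewrite /N ltr0n.
  have := munu (N n ^- 2) (c + (N n)^-1) (d + (N n)^-1).
  rewrite invr_gt0 exprn_gt0// ltrD2r => /(_ isT cd).
  have E x a : (a + (N n)^-1 - x) / N n ^- 2 = (a - x) * N n ^+ 2 + N n.
    by field; rewrite gt_eqF.
  have F (m : {finite_measure set rT -> \bar R}) :
      (\int[m]_x (atan ((d + (N n)^-1 - x) / N n ^- 2) -
       atan ((c + (N n)^-1 - x) / N n ^- 2))%:E)%E = (\int[m]_x (G c d n x)%:E)%E.
    by apply: eq_integral => x _; rewrite !E.
  by rewrite /Rintegral !F => ->.
have lG c d (m : {finite_measure set rT -> \bar R}) : c < d ->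
  (\int[m]_x G c d n x)%R @[n --> \oo] --> pi * fine (m `]c, d]%classic).
  move=> cd.
  have [|||| _] := @cvg_Rintegral_dominated _ rT R m setT measurableT (G c d)
    (fun x => pi * \1_(`]c, d]%classic : set rT) x) (fun=> pi).
  - exact: mG.
  - move=> x _; have h : G c d n x @[n --> \oo] --> _ :=
      cvgB (@cvg_atan_step (d - x)) (@cvg_atan_step (c - x)).
    rewrite (_ : pi * _ = (if 0 <= d - x then pi / 2 else - (pi / 2)) -
      (if 0 <= c - x then pi / 2 else - (pi / 2))); first by apply: h.
    rewrite !subr_ge0 indicE.
    have -> : (x \in (`]c, d]%classic : set rT)) = (c < x <= d).
      apply/idP/idP => [/set_mem|xcd]; first by rewrite /= in_itv.
      by apply/mem_set; rewrite /= in_itv.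
    case: (boolP (c < x <= d)).
      by move=> /andP[cx xd]; rewrite xd leNgt cx/= mulr1; field.
    rewrite negb_and -!ltNge -leNgt mulr0 => /orP[xc|dx].
      by rewrite xc (le_trans xc (ltW cd)) subrr.
    by rewrite !leNgt dx (lt_trans cd dx) /= subrr.
  - exact: finite_measure_integrable_cst.
  - by move=> n x _; exact: bG.
  rewrite RintegralZl//; last exact: integrable_indic.
  by rewrite /Rintegral integral_indic// setIT.
apply: (@measure_unique _ R rT (@ocitv R) (fun k => `](- k%:R)%R, k%:R]%classic)).
- by [].
- exact: ocitvI.
- by move=> k; exact: is_ocitv.
- exact: bigcup_itvT.
- move=> _ [[c d] _ <-] /=.
  have [cd|dc] := ltP c d; last by rewrite set_itv_ge ?bnd_simp -?leNgt// !measure0.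
  have h1 := lG c d mu cd; have h2 := lG c d nu cd.
  have E : (fun n => (\int[mu]_x G c d n x)%R) = (fun n => (\int[nu]_x G c d n x)%R).
    by apply/funext => n; exact: GE.
  rewrite E in h1.
  have piE : pi * fine (mu `]c, d]%classic) = pi * fine (nu `]c, d]%classic).
    exact: (cvg_unique _ h1 h2).
  have H := mulfI (lt0r_neq0 (pi_gt0 R)) piE.
  rewrite -[LHS]fineK ?fin_num_measure// H fineK// fin_num_measure//.
- by move=> k; rewrite -ge0_fin_numE// fin_num_measure.
Qed.

End CharfunUnique.

(** * The bilateral gamma law *)

Section Density.
Context {R : realType}.
Local Notation leb := (@lebesgue_measure R).
Local Notation rT := (measurableTypeR R).

(* The proofs [g0] and [ig] are arguments so that the measure instances can be inferred. *)
Definition density_measure (g : R -> R) (g0 : forall x, 0 <= g x)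
  (ig : leb.-integrable [set: rT] (EFin \o g)) : set rT -> \bar R :=
  fun A => (\int[leb]_(x in A) (g x)%:E)%E.

Section DensityMeasure.
Context (g : R -> R) (g0 : forall x, 0 <= g x)
  (ig : leb.-integrable [set: rT] (EFin \o g)).
Local Notation nu := (density_measure g0 ig).

Let nu0 : nu set0 = 0%E. Proof. exact: integral_set0. Qed.

Let nu_ge0 A : (0 <= nu A)%E.
Proof. by apply: integral_ge0 => x _; rewrite lee_fin. Qed.

Let nu_sigma_additive : semi_sigma_additive nu.
Proof.
move=> /= F mF tF mUF; rewrite /density_measure integral_bigcup//=; last first.
  exact: (integrableS _ _ (@subsetT _ _) ig).
by apply: is_cvg_ereal_nneg_natsum_cond => n _ _; exact: nu_ge0.
Qed.

HB.instance Definition _ := isMeasure.Build _ _ _ nu nu0 nu_ge0 nu_sigma_additive.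

Let nu_fin : fin_num_fun nu.
Proof.
move=> A mA; apply: integrable_fin_num => //.
exact: (integrableS _ _ (@subsetT _ _) ig).
Qed.

HB.instance Definition _ := @Measure_isFinite.Build _ _ _ nu nu_fin.

Let mg : measurable_fun [set: rT] (EFin \o g). Proof. exact: measurable_int ig. Qed.

Import HBNNSimple.

(** True by definition for indicators, hence for simple functions; monotone convergence on both
    sides does the rest. *)
Lemma ge0_integral_density (f : rT -> R) : (forall x, 0 <= f x) ->
  measurable_fun [set: rT] f ->
  (\int[nu]_x (f x)%:E = \int[leb]_x (f x * g x)%:E)%E.
Proof.
move=> f0 mf.
have mfE : measurable_fun [set: rT] (EFin \o f) by exact/measurable_EFinP.
pose h := nnsfun_approx measurableT mfE.
have hf x : (EFin \o h n) x @[n --> \oo] --> (f x)%:E.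
  by apply: (cvg_nnsfun_approx measurableT mfE) => // y _; rewrite lee_fin.
have hn n x : (0 <= (h n x)%:E)%E by rewrite lee_fin.
have L : (\int[nu]_x (h n x)%:E)%E @[n --> \oo] --> (\int[nu]_x (f x)%:E)%E.
  rewrite (_ : (\int[nu]_x (f x)%:E)%E = (\int[nu]_x limn (EFin \o h ^~ x))%E).
    apply: cvg_monotone_convergence => //.
    - by move=> n; apply/measurable_EFinP.
    - by move=> x _ a b ab; rewrite lee_fin; exact/lefP/nd_nnsfun_approx.
  by apply: eq_integral => x _; apply/esym/cvg_lim => //; exact: hf.
have L' : (\int[leb]_x (h n x * g x)%:E)%E @[n --> \oo] --> (\int[leb]_x (f x * g x)%:E)%E.
  rewrite (_ : (\int[leb]_x (f x * g x)%:E)%E = (\int[leb]_x limn (fun n => (h n x * g x)%:E))%E).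
    apply: cvg_monotone_convergence => //.
    - move=> n; apply/measurable_EFinP; apply: measurable_funM => //.
      exact/measurable_EFinP.
    - by move=> n x _; rewrite lee_fin mulr_ge0.
    - move=> x _ a b ab; rewrite lee_fin ler_wpM2r//; exact/lefP/nd_nnsfun_approx.
  apply: eq_integral => x _; apply/esym/cvg_lim => //.
  rewrite EFinM; under eq_fun do rewrite EFinM.
  by apply: cvgeZr => //; exact: hf.
have E n : (\int[nu]_x (h n x)%:E = \int[leb]_x (h n x * g x)%:E)%E.
  rewrite integralT_nnsfun sintegralE.
  transitivity (\int[leb]_x ((\sum_(y \in range (h n)) (y * \1_(h n @^-1` [set y]) x)%:E) * (g x)%:E))%E; last first.
    by apply: eq_integral => x _; rewrite EFinM fimfunE -fsumEFin.
  transitivity (\int[leb]_x (\sum_(y \in range (h n)) ((y * \1_(h n @^-1` [set y]) x)%:E * (g x)%:E)))%E; last first.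
    apply: eq_integral => x _; rewrite ge0_mule_fsuml// => y.
    exact: nnfun_muleindic_ge0.
  rewrite ge0_integral_fsum//; last 2 first.
    - move=> y; apply: emeasurable_funM => //; apply/measurable_EFinP.
      exact: measurable_funM.
    - by move=> y x _; apply: mule_ge0; [exact: nnfun_muleindic_ge0|rewrite lee_fin].
  apply: eq_fsbigr => y /[!inE] -[t _ <-].
  under [RHS]eq_integral do rewrite EFinM -muleA.
  rewrite ge0_integralZl//; last 2 first.
  - by apply: emeasurable_funM => //; apply/measurable_EFinP.
  - by move=> x _; rewrite mule_ge0 ?lee_fin.
  congr (_ * _)%E.
  rewrite -[LHS]/(\int[leb]_(x in h n @^-1` [set h n t]) (g x)%:E)%E.
  rewrite [LHS]integral_mkcond; apply: eq_integral => x _.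
  rewrite patchE indicE; case: ifPn => _; first by rewrite mul1e.
  by rewrite mul0e.
move: L; rewrite (_ : (fun n => _) = (fun n => (\int[leb]_x (h n x * g x)%:E)%E)); last first.
  by apply/funext => n; exact: E.
by move=> L; exact: (cvg_unique _ L L').
Qed.

Lemma integrable_density (f : rT -> R) : measurable_fun [set: rT] f ->
  (forall x, `|f x| <= 1) -> leb.-integrable [set: rT] (EFin \o (fun x => f x * g x)).
Proof.
move=> mf f1; apply: (le_integrable _ _ _ ig) => //.
  by apply/measurable_EFinP; apply: measurable_funM => //; exact/measurable_EFinP.
by move=> x _; rewrite /= lee_fin normrM ler_piMl.
Qed.

Lemma Rintegral_density (f : rT -> R) : measurable_fun [set: rT] f ->
  (forall x, `|f x| <= 1) -> (\int[nu]_x f x)%R = (\int[leb]_x (f x * g x))%R.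
Proof.
move=> mf f1.
have If : nu.-integrable [set: rT] (EFin \o f) by exact: integrable_bounded f1.
have I1 : nu.-integrable [set: rT] (EFin \o cst 1) by exact: finite_measure_integrable_cst.
have Ifg := integrable_density mf f1.
have f1_ge0 x : 0 <= f x + 1.
  by have := f1 x; rewrite ler_norml -lerBlDr sub0r => /andP[].
(* As |f| <= 1, f + 1 is nonnegative; the constant 1 is treated alike and subtracted. *)
have E1 : (\int[nu]_x (f x + 1))%R = (\int[leb]_x ((f x + 1) * g x))%R.
  by congr fine; apply: ge0_integral_density => //; apply: measurable_funD.
have E2 : (\int[nu]_x 1)%R = (\int[leb]_x g x)%R.
  rewrite -[LHS]/(fine (\int[nu]_x ((cst 1 : rT -> R) x)%:E)%E) ge0_integral_density//.
  by congr fine; apply: eq_integral => x _; rewrite /= mul1r.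
apply: (@addIr _ (\int[nu]_x 1)%R); rewrite -RintegralD// E1 E2 -RintegralD//.
by apply: eq_Rintegral => x _; rewrite mulrDl mul1r.
Qed.

End DensityMeasure.
End Density.

(** * Characteristic function of the bilateral gamma law *)

Section BilateralCharfun.
Context {R : realType}.
Local Notation leb := (@lebesgue_measure R).
Local Notation rT := (measurableTypeR R).
Implicit Types (alpha beta u : R).

Lemma Rintegral_cosB_prod (m : {finite_measure set rT -> \bar R}) u (c s : R) :
  c = (\int[m]_x cos (u * x))%R -> s = (\int[m]_x sin (u * x))%R ->
  charfun (pushforward (m \x m)%E (fun z : rT * rT => (z.1 - z.2)%R : rT)) u =
  ((c ^+ 2 + s ^+ 2)%:C)%C.
Proof.
move=> cE sE.
have msub : measurable_fun [set: rT * rT] (fun z : rT * rT => (z.1 - z.2)%R : rT).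
  by apply: measurable_funB.
(* One application of Fubini for both parts: (p, q, r, t) are the coefficients in the addition
   formula, (1, 0, 0, 1) for cosine and (0, -1, 1, 0) for sine. The latter makes the imaginary part
   cancel. *)
have key (h : R -> R) (p q r t : R) : (forall x y, h (u * (x - y)) =
    cos (u * x) * (p * cos (u * y) + q * sin (u * y)) +
    sin (u * x) * (r * cos (u * y) + t * sin (u * y))) ->
    continuous h -> (forall x, `|h x| <= 1) ->
    fine (\int[pushforward (m \x m)%E (fun z : rT * rT => (z.1 - z.2)%R : rT)]_x (h (u * x))%:E)%E
    = c * (p * c + q * s) + s * (r * c + t * s).
  move=> hE ch h1.
  have mh : measurable_fun [set: rT] (fun x : rT => h (u * x)).
    by apply: (measurableT_comp (continuous_measurable_fun ch)); apply: measurable_funM.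
  pose f (z : rT * rT) := (h (u * (z.1 - z.2)))%:E.
  have mf : measurable_fun [set: rT * rT] f.
    by apply/measurable_EFinP; exact: measurableT_comp mh msub.
  have If : (m \x m)%E.-integrable [set: rT * rT] f.
    apply/(integrable12ltyP _ _ mf).
    apply: (@le_lt_trans _ _ (\int[m]_x (\int[m]_y 1))%E).
      apply: ge0_le_integral => //.
      - by move=> x _; apply: integral_ge0.
      - have mabs : measurable_fun [set: rT * rT] (abse \o f) by exact: measurableT_comp.
        apply: (@measurable_fun_fubini_tonelli_F _ _ rT rT R m (abse \o f)) => // z.
        exact: abse_ge0.
      - move=> x _; apply: ge0_le_integral => //.
        + by apply: measurableT_comp => //; exact: measurableT_comp mf (measurable_pair1 x).
        + by move=> y _; rewrite /f/= lee_fin.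
    have mT : (m [set: rT] < +oo)%E by rewrite -ge0_fin_numE// fin_num_measure.
    have -> : (\int[m]__ 1 = m [set: rT])%E by rewrite integral_cst// mul1e.
    by rewrite integral_cst// lte_mul_pinfty// fin_num_measure.
  rewrite integral_pushforward//; last by apply/measurable_EFinP.
  rewrite -[X in fine X]/(\int[(m \x m)%E]_z f z)%E.
  rewrite -integral12_prod_meas1//.
  have Ic := integrable_cosM m u; have Is := integrable_sinM m u.
  have lin a b : m.-integrable [set: rT] (EFin \o (fun y => a * cos (u * y) + b * sin (u * y))) /\
     (\int[m]_y (a * cos (u * y) + b * sin (u * y)))%R = a * c + b * s.
    have Jc := integrable_scaler measurableT a Ic.
    have Js := integrable_scaler measurableT b Is.
    split; first exact: integrable_addr.
    by rewrite RintegralD// !RintegralZl// cE sE.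
  transitivity (\int[m]_x ((p * c + q * s) * cos (u * x) + (r * c + t * s) * sin (u * x)))%R.
    congr fine; apply: eq_integral => x _.
    transitivity (\int[m]_y (h (u * (x - y))))%R%:E.
      rewrite /fubini_F /Rintegral fineK//; apply: integrable_fin_num => //.
      apply: (@integrable_bounded _ _ _ m (fun y : rT => h (u * (x - y))) 1) => //.
      by apply: (measurableT_comp mh); apply: measurable_funB.
    congr EFin.
    have [J1 E1] := lin p q; have [J2 E2] := lin r t.
    have K1 := integrable_scaler measurableT (cos (u * x)) J1.
    have K2 := integrable_scaler measurableT (sin (u * x)) J2.
    under eq_Rintegral do rewrite hE.
    rewrite RintegralD// RintegralZl// E1 RintegralZl// E2; ring.
  rewrite (lin _ _).2; ring.
rewrite /charfun (key cos 1 0 0 1) ?(key sin 0 (-1) 1 0).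
- by apply/eqP; rewrite eq_complex /=; apply/andP; split; apply/eqP; ring.
- by move=> x y; rewrite mulrBr sinB; ring.
- exact: continuous_sin.
- exact: norm_sin_le1.
- by move=> x y; rewrite mulrBr cosB; ring.
- exact: continuous_cos.
- exact: norm_cos_le1.
Qed.

(** A zero integral would make the strictly positive kernel vanish almost everywhere on a half line
    of infinite measure. *)
Lemma gamma_cos0_gt0 alpha beta : 0 < alpha -> 0 < beta -> 0 < gamma_cos alpha beta 0.
Proof.
move=> a0 b0.
have mD : measurable (`]0%R, +oo[%classic : set rT) by exact: measurable_itv.
have E : gamma_cos alpha beta 0 = (\int[leb]_(x in `]0%R, +oo[) gamma_kernel alpha beta x)%R.
  by apply: eq_Rintegral => x _; rewrite mul0r cos0 mulr1.
rewrite lt_neqAle E Rintegral_ge0 ?andbT; last by move=> x _; exact: gamma_kernel_ge0.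
apply/eqP => /esym E0.
have I := integrable_gamma_kernel a0 b0.
have : (\int[leb]_(x in `]0%R, +oo[) `|(gamma_kernel alpha beta x)%:E| = 0)%E.
  under eq_integral do rewrite abse_EFin ger0_norm ?gamma_kernel_ge0//.
  by rewrite -[LHS]fineK ?integrable_fin_num// -[fine _]/(Rintegral _ _ _) E0.
have mk : measurable_fun (`]0%R, +oo[%classic : set rT) (EFin \o gamma_kernel alpha beta).
  exact: measurable_int I.
move/(ae_eq_integral_abs leb mD mk) => -[N [mN N0 sub]].
have : (leb `]0%R, +oo[%classic <= leb N)%E.
  rewrite le_measure ?inE// => x x0; apply: sub => /= /(_ x0) [].
  move: x0; rewrite /= in_itv/= andbT => x0 /eqP.
  by rewrite gt_eqF// mulr_gt0 ?powR_gt0 ?expR_gt0.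
by rewrite N0 lebesgue_measure_itv/= ltry.
Qed.

Lemma gamma_pdfE alpha beta : gamma_pdf alpha beta =
  (fun x => beta `^ alpha / euler_gamma alpha * gamma_kernel alpha beta x) \_ (`]0%R, +oo[%classic : set R).
Proof.
by apply/funext => x; rewrite /gamma_pdf !patchE; case: ifPn => // _; rewrite !mulrA.
Qed.

Lemma euler_gammaE alpha : euler_gamma alpha = gamma_cos alpha 1 0.
Proof.
congr fine; apply: eq_integral => x _.
by rewrite mul0r cos0 mulr1 /gamma_kernel mul1r.
Qed.

(** The normalization is left as an unevaluated [k], because it cancels from the remainder equation
    as soon as it is nonzero. *)
Lemma bilateral_charfun alpha beta : 0 < alpha -> 0 < beta ->
  exists2 k : R, k != 0 & forall u,
  charfun (bilateral_gamma_law alpha beta) u =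
  ((k * (beta ^+ 2 / (beta ^+ 2 + u ^+ 2)) `^ alpha)%:C)%C.
Proof.
move=> a0 b0.
have mD : measurable (`]0%R, +oo[%classic : set rT) by exact: measurable_itv.
pose K := beta `^ alpha / euler_gamma alpha.
have K0 : 0 < K.
  by rewrite divr_gt0 ?powR_gt0// euler_gammaE gamma_cos0_gt0.
have g0 x : 0 <= gamma_pdf alpha beta x.
  rewrite gamma_pdfE patchE; case: ifPn => // _.
  exact: mulr_ge0 (ltW K0) (gamma_kernel_ge0 _ _ _).
have Ig : leb.-integrable [set: rT] (EFin \o gamma_pdf alpha beta).
  rewrite gamma_pdfE -restrict_EFin; apply/integrable_restrict => //.
  by rewrite setTI; apply: integrable_scaler => //; exact: integrable_gamma_kernel.
have hE (h : R -> R) : measurable_fun [set: rT] h -> (forall x, `|h x| <= 1) ->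
    (\int[density_measure g0 Ig]_x h x)%R =
    K * (\int[leb]_(x in `]0%R, +oo[) (gamma_kernel alpha beta x * h x))%R.
  move=> mh h1; rewrite Rintegral_density// -RintegralZl//; last first.
    exact: integrable_gamma_kernelM.
  rewrite [RHS]Rintegral_mkcond; apply: eq_Rintegral => x _.
  rewrite gamma_pdfE !patchE; case: ifPn => _; first by rewrite -/K; ring.
  by rewrite mulr0.
exists ((K * gamma_cos alpha beta 0) ^+ 2).
  by rewrite sqrf_eq0 gt_eqF// mulr_gt0// gamma_cos0_gt0.
(* [gamma_law] is a bare set function, convertible to [density_measure], which carries the finite
   measure structure that Fubini requires. *)
move=> u; rewrite -[bilateral_gamma_law _ _]/(pushforward (density_measure g0 Ig \x density_measure g0 Ig)%E
  (fun z : rT * rT => (z.1 - z.2)%R : rT)).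
rewrite (@Rintegral_cosB_prod _ u (K * gamma_cos alpha beta u) (K * gamma_sin alpha beta u)).
- congr (_%:C)%C.
  by rewrite !exprMn -mulrDr gamma_modulus// mulrA.
- by rewrite hE//; [exact: measurable_cosM|move=> x; exact: norm_cos_le1].
- by rewrite hE//; [exact: measurable_sinM|move=> x; exact: norm_sin_le1].
Qed.

End BilateralCharfun.

(** * The law of the remainder *)

Section FbarMixture.
Context {R : realType} (w : R^nat) (b : R) (w_ge0 : forall i, 0 <= w i)
  (cvg_w : cvgn (series w)) (b_gt0 : 0 < b).
Local Notation leb := (@lebesgue_measure R).
Local Notation rT := (measurableTypeR R).

(** Index i stands for k = i + 1, so the term k = 0, which becomes the atom, stays outside. *)
Definition fbar_mixture (x : R) : R := limn (series (fun i => w i * fbar i.+1 b x)).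

Let nondecreasing_series_w : nondecreasing_seq (series w).
Proof. by apply/nondecreasing_seqP => n; rewrite /series/= big_nat_recr//= lerDl. Qed.

Let nondecreasing_mixture x : nondecreasing_seq (series (fun i => w i * fbar i.+1 b x)).
Proof.
apply/nondecreasing_seqP => n; rewrite /series/= big_nat_recr//= lerDl.
by rewrite mulr_ge0// fbar_ge0// ltW.
Qed.

(** Summable weights and the uniform bound b/2 give convergence at every point, 0 included. *)
Lemma cvg_fbar_mixture x : series (fun i => w i * fbar i.+1 b x) @ \oo --> fbar_mixture x.
Proof.
apply: nondecreasing_is_cvgn => //.
exists (limn (series w) * (b / 2)) => _ [n _ <-]; rewrite /series/=.
apply: (@le_trans _ _ (series w n * (b / 2))).
  by rewrite /series/= mulr_suml; apply: ler_sum => i _; rewrite ler_wpM2l// fbar_le.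
apply: ler_wpM2r; first by rewrite divr_ge0// ltW.
exact: (nondecreasing_cvgn_le nondecreasing_series_w cvg_w).
Qed.

Lemma fbar_mixture_ge0 x : 0 <= fbar_mixture x.
Proof.
have /(_ 0%N) := nondecreasing_cvgn_le (nondecreasing_mixture x)
  (cvgP _ (@cvg_fbar_mixture x)).
by rewrite /series/= big_nil.
Qed.

Let mS n : measurable_fun [set: rT] (fun x => series (fun i => w i * fbar i.+1 b x) n).
Proof.
rewrite /series/=; elim: n => [|n IH].
  by rewrite (_ : (fun _ => _) = cst 0)//; apply/funext => x; rewrite big_nil.
rewrite (_ : (fun _ => _) = (fun x => \sum_(0 <= i < n) w i * fbar i.+1 b x + w n * fbar n.+1 b x)).
  by apply: measurable_funD => //; apply: measurable_funM => //; exact: measurable_fbar.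
by apply/funext => x; rewrite big_nat_recr.
Qed.

Lemma measurable_fbar_mixture : measurable_fun [set: rT] fbar_mixture.
Proof. by apply: (measurable_fun_cvg mS) => x _; exact: cvg_fbar_mixture. Qed.

Let Rintegral_partial_mixture n (h : R -> R) (c : R^nat) :
  measurable_fun [set: rT] h -> (forall x, `|h x| <= 1) ->
  (forall i, (\int[leb]_x (fbar i.+1 b x * h x))%R = c i) ->
  leb.-integrable [set: rT]
    (EFin \o (fun x => series (fun i => w i * fbar i.+1 b x) n * h x)) /\
  (\int[leb]_x (series (fun i => w i * fbar i.+1 b x) n * h x))%R =
  series (fun i => w i * c i) n.
Proof.
move=> mh h1 hc.
have I i : leb.-integrable [set: rT] (EFin \o (fun x => fbar i.+1 b x * h x)).
  apply: (le_integrable _ _ _ (integrable_fbar i b_gt0)) => //.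
    by apply/measurable_EFinP; apply: measurable_funM => //; exact: measurable_fbar.
  move=> x _; have F0 : 0 <= fbar i.+1 b x by rewrite fbar_ge0// ltW.
  by rewrite /= lee_fin normrM (ger0_norm F0) ler_piMr.
have E : (fun x => series (fun i => w i * fbar i.+1 b x) n * h x) =
    (fun x => \sum_(0 <= i < n) w i * (fbar i.+1 b x * h x)).
  by apply/funext => x; rewrite /series/= mulr_suml; apply: eq_bigr => i _; rewrite mulrA.
rewrite E.
have [I2 E2] := @integrable_sum_nat _ rT R leb setT measurableT n
  (fun i x => w i * (fbar i.+1 b x * h x))
  (fun i => integrable_scaler measurableT (w i) (I i)).
split => //; rewrite E2 /series/=; apply: eq_bigr => i _.
by rewrite RintegralZl// hc.
Qed.

Lemma integrable_fbar_mixture : leb.-integrable [set: rT] (EFin \o fbar_mixture).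
Proof.
have mg := measurable_fbar_mixture.
apply/integrableP; split; first exact/measurable_EFinP.
under eq_integral do rewrite /= ger0_norm ?fbar_mixture_ge0//.
have L : (\int[leb]_x (series (fun i => w i * fbar i.+1 b x) n)%:E)%E @[n --> \oo] -->
    (\int[leb]_x (fbar_mixture x)%:E)%E.
  rewrite (_ : (\int[leb]_x (fbar_mixture x)%:E)%E =
    (\int[leb]_x limn (fun n => (series (fun i => w i * fbar i.+1 b x) n)%:E))%E).
    apply: cvg_monotone_convergence => //.
    - by move=> n; apply/measurable_EFinP.
    - move=> n x _; rewrite lee_fin /series/= sumr_ge0// => i _.
      by rewrite mulr_ge0// fbar_ge0// ltW.
    - by move=> x _ i j ij; rewrite lee_fin; exact: nondecreasing_mixture.
  apply: eq_integral => x _; apply/esym/cvg_lim => //.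
  by apply: cvg_EFin; [exact: nearW|exact: cvg_fbar_mixture].
have E n : (\int[leb]_x (series (fun i => w i * fbar i.+1 b x) n)%:E)%E = (series w n)%:E.
  have [|||I E] := @Rintegral_partial_mixture n (cst 1) (cst 1).
  - exact: measurable_cst.
  - by move=> x; rewrite normr1.
  (* The total mass of each component is read off its cosine transform at u = 0. *)
  - move=> i; transitivity (\int[leb]_x (fbar i.+1 b x * cos (0 * x)))%R.
      by apply: eq_Rintegral => x _; rewrite mul0r cos0.
    rewrite fbar_cos// expr0n/= addr0 divff ?expr1n//.
    by rewrite expf_neq0 ?gt_eqF.
  have -> : series w n = series (fun i => w i * (cst 1 : R^nat) i) n.
    by rewrite /series/=; apply: eq_bigr => i _; rewrite mulr1.
  rewrite -E /Rintegral fineK; last exact: integrable_fin_num.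
  by apply: eq_integral => x _; rewrite /= mulr1.
move: L; rewrite (_ : (fun n => _) = (fun n => (series w n)%:E)); last by apply/funext.
move=> L; have L' : (series w n)%:E @[n --> \oo] --> (limn (series w))%:E.
  by apply: cvg_EFin; [exact: nearW|].
by rewrite (cvg_unique _ L L') ?ltry//; exact: ereal_hausdorff.
Qed.

(** Since the terms are nonnegative, the mixture itself dominates its partial sums. *)
Lemma Rintegral_fbar_mixture (h : R -> R) (c : R^nat) :
  measurable_fun [set: rT] h -> (forall x, `|h x| <= 1) ->
  (forall i, (\int[leb]_x (fbar i.+1 b x * h x))%R = c i) ->
  series (fun i => w i * c i) @ \oo --> (\int[leb]_x (h x * fbar_mixture x))%R.
Proof.
move=> mh h1 hc.
have P n := @Rintegral_partial_mixture n h c mh h1 hc.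
have -> : series (fun i => w i * c i) =
    (fun n => (\int[leb]_x (series (fun i => w i * fbar i.+1 b x) n * h x))%R).
  by apply/funext => n; rewrite (P n).2.
have [||||_] := @cvg_Rintegral_dominated _ rT R leb setT measurableT
  (fun n x => series (fun i => w i * fbar i.+1 b x) n * h x)
  (fun x => h x * fbar_mixture x) fbar_mixture.
- by move=> n; apply: measurable_funM.
- by move=> x _; rewrite mulrC; apply: cvgM; [exact: cvg_fbar_mixture|exact: cvg_cst].
- exact: integrable_fbar_mixture.
- move=> n x _; have S0 : 0 <= series (fun i => w i * fbar i.+1 b x) n.
    by rewrite /series/= sumr_ge0// => i _; rewrite mulr_ge0// fbar_ge0// ltW.
  rewrite normrM ger0_norm//; apply: (@le_trans _ _ (series (fun i => w i * fbar i.+1 b x) n)).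
    by rewrite ler_piMr.
  apply: (nondecreasing_cvgn_le (nondecreasing_mixture x)).
  exact: (cvgP _ (@cvg_fbar_mixture x)).
by [].
Qed.

End FbarMixture.

(** * Measures with an atom at 0 and a density *)

Section AtomDensity.
Context {R : realType} (c : R) (g : R -> R) (c_ge0 : 0 <= c) (g0 : forall x, 0 <= g x).
Local Notation leb := (@lebesgue_measure R).
Local Notation rT := (measurableTypeR R).
Context (ig : leb.-integrable [set: rT] (EFin \o g)).

Let delta := mscale (NngNum c_ge0) (\d_(0%R : rT)).

Definition atom_density : set rT -> \bar R := measure_add delta (density_measure g0 ig).

HB.instance Definition _ := Measure.on atom_density.

Lemma atom_densityE A :
  atom_density A = (c%:E * \d_(0%R : rT) A + \int[leb]_(x in A) (g x)%:E)%E.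
Proof. by rewrite /atom_density measure_addE. Qed.

Let atom_density_fin : fin_num_fun atom_density.
Proof.
move=> A mA; rewrite atom_densityE fin_numD; apply/andP; split.
  by rewrite fin_numM// fin_num_measure.
by apply: integrable_fin_num => //; exact: (integrableS _ _ (@subsetT _ _) ig).
Qed.

HB.instance Definition _ := @Measure_isFinite.Build _ _ _ atom_density atom_density_fin.

Lemma Rintegral_atom_density (f : rT -> R) : measurable_fun [set: rT] f ->
  (forall x, `|f x| <= 1) ->
  (\int[atom_density]_x f x)%R = c * f 0 + (\int[leb]_x (f x * g x))%R.
Proof.
move=> mf f1; have mE : measurable_fun [set: rT] (EFin \o f) by exact/measurable_EFinP.
have I1 : delta.-integrable [set: rT] (EFin \o f).
  apply/integrableP; split => //.
  rewrite ge0_integral_mscale//; last exact: measurableT_comp.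
  by rewrite integral_dirac//; [rewrite diracT mul1e ltry|exact: measurableT_comp].
have I2 : (density_measure g0 ig).-integrable [set: rT] (EFin \o f).
  exact: integrable_bounded f1.
have E1 : (\int[delta]_x (f x)%:E = (c * f 0)%:E)%E.
  rewrite integralE !ge0_integral_mscale//=; [|exact: measurable_funeneg|exact: measurable_funepos].
  rewrite !integral_dirac//=; [|exact: measurable_funeneg|exact: measurable_funepos].
  rewrite diracT !mul1e -muleBr//; last exact: add_def_funeposneg.
  have /= <- := congr1 (fun h => h (0 : rT)) (funeposneg (EFin \o f)).
  by rewrite EFinM.
rewrite -Rintegral_density// /Rintegral -[X in fine X]/(\int[measure_add delta (density_measure g0 ig)]_x (f x)%:E)%E.
rewrite integral_measure_add// E1 fineD//.
exact: integrable_fin_num.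
Qed.

End AtomDensity.

(** * The quotient of characteristic functions and its expansion *)

Lemma cvg_rising_binomialM (R : realType) (alpha a q : R) :
  0 < alpha -> 0 < a < 1 -> 0 <= q <= 1 ->
  (fun n : nat => \sum_(0 <= k < n)
     rising_binomial alpha k * a `^ (2 * alpha) * (1 - a ^+ 2) ^+ k * q ^+ k) @ \oo -->
  a `^ (2 * alpha) * (1 - (1 - a ^+ 2) * q) `^ (- alpha).
Proof.
move=> alpha0 /andP[a0 a1] /andP[q0 q1].
have a21 : a ^+ 2 < 1 by rewrite expr_lt1// ltW.
have a20 : 0 < a ^+ 2 by rewrite exprn_gt0.
(* Positivity of a keeps this below 1 even for q = 1, the case that later gives the summability of
   the weights. *)
have zq : 0 <= (1 - a ^+ 2) * q < 1.
  by apply/andP; split; nra.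
rewrite (_ : (fun n => _) =
    (fun n => a `^ (2 * alpha) * pseries (rising_binomial alpha) ((1 - a ^+ 2) * q) n)).
  by apply: cvgM; [exact: cvg_cst|exact: cvg_rising_binomial].
apply/funext => n; rewrite /pseries /series/= mulr_sumr; apply: eq_bigr => k _.
by rewrite exprMn; ring.
Qed.

(** Rests on 1 - (1 - a^2) q = a^2 (beta^2 + u^2)/(beta^2 + a^2 u^2), whose power -alpha, times a^(2
    alpha), is the quotient of the values at u and a u. *)
Lemma powR_remainder (R : realType) (alpha beta a u : R) : 0 < beta -> 0 < a ->
  (beta ^+ 2 / (beta ^+ 2 + u ^+ 2)) `^ alpha =
  (beta ^+ 2 / (beta ^+ 2 + (a * u) ^+ 2)) `^ alpha *
  (a `^ (2 * alpha) *
   (1 - (1 - a ^+ 2) * (beta ^+ 2 / (beta ^+ 2 + a ^+ 2 * u ^+ 2))) `^ (- alpha)).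
Proof.
move=> b0 a0; have b20 : 0 < beta ^+ 2 by rewrite exprn_gt0.
have a20 : 0 < a ^+ 2 by rewrite exprn_gt0.
have N0 : 0 < beta ^+ 2 + u ^+ 2 by rewrite ltr_wpDr ?sqr_ge0.
have D0 : 0 < beta ^+ 2 + a ^+ 2 * u ^+ 2 by rewrite ltr_wpDr// mulr_ge0 ?sqr_ge0.
rewrite exprMn.
have -> : 1 - (1 - a ^+ 2) * (beta ^+ 2 / (beta ^+ 2 + a ^+ 2 * u ^+ 2)) =
    a ^+ 2 * (beta ^+ 2 + u ^+ 2) / (beta ^+ 2 + a ^+ 2 * u ^+ 2).
  by field; rewrite exprMn gt_eqF.
rewrite powRrM -[2]/(2%:R) powR_mulrn ?ltW// powRN mulrA; apply/(canRL (mulfK _)).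
  by rewrite gt_eqF// powR_gt0// !(divr_gt0, mulr_gt0).
rewrite -!powRM ?ltW ?(divr_gt0, mulr_gt0)//.
by congr (_ `^ _); field; rewrite ?exprMn !gt_eqF.
Qed.

Theorem corollary3p5 (R : realType) (alpha beta a : R)
    (alpha_gt0 : 0 < alpha) (beta_gt0 : 0 < beta)
    (a_gt0 : 0 < a) (a_lt1 : a < 1)
    (P : probability (measurableTypeR R) R)
    (P_rem : is_remainder a (bilateral_gamma_law alpha beta) P) :
  (forall u : R, exists2 s : R,
     (fun n : nat => \sum_(0 <= k < n)
        rising_binomial alpha k * a `^ (2 * alpha) * (1 - a ^+ 2) ^+ k *
        (beta ^+ 2 / (beta ^+ 2 + a ^+ 2 * u ^+ 2)) ^+ k) @ \oo --> s &
     charfun P u = (s%:C)%C) /\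
  (exists2 g : R -> R,
     forall x : R, x != 0 ->
       (fun n : nat => \sum_(1 <= k < n)
          rising_binomial alpha k * a `^ (2 * alpha) * (1 - a ^+ 2) ^+ k *
          fbar k (beta / a) x) @ \oo --> g x &
     has_generalized_density P (a `^ (2 * alpha)) g).
Proof.
pose c := a `^ (2 * alpha); have c0 : 0 <= c := powR_ge0 _ _.
have a01 : 0 < a < 1 by rewrite a_gt0.
pose q u := beta ^+ 2 / (beta ^+ 2 + a ^+ 2 * u ^+ 2).
pose s u := c * (1 - (1 - a ^+ 2) * q u) `^ (- alpha).
have q01 u : 0 <= q u <= 1.
  have b20 : 0 < beta ^+ 2 by rewrite exprn_gt0.
  have au0 : 0 <= a ^+ 2 * u ^+ 2 by rewrite mulr_ge0 ?sqr_ge0.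
  have D0 : 0 < beta ^+ 2 + a ^+ 2 * u ^+ 2 by rewrite ltr_wpDr.
  rewrite /q ler_pdivrMr// mul1r lerDl au0 andbT.
  by apply: divr_ge0; apply: ltW.
have P_charfun u : charfun P u = ((s u)%:C)%C.
  have [k k0 kE] := bilateral_charfun alpha_gt0 beta_gt0.
  have := P_rem u; rewrite !kE (powR_remainder _ _ beta_gt0 a_gt0) mulrA rmorphM.
  (* The factor at a u is nonzero and cancels, and [k] with it. *)
  move/mulfI => ->//.
  rewrite fmorph_eq0 mulf_neq0// gt_eqF// powR_gt0// divr_gt0 ?exprn_gt0//.
  by rewrite ltr_wpDr ?sqr_ge0// exprn_gt0.
split; first by move=> u; exists (s u); [exact: (cvg_rising_binomialM alpha_gt0 a01 (q01 u))|exact: P_charfun].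
pose p k := rising_binomial alpha k * c * (1 - a ^+ 2) ^+ k.
have p_ge0 k : 0 <= p k.
  have z0 : 0 <= 1 - a ^+ 2 by rewrite subr_ge0 expr_le1 ?ltW.
  by apply: mulr_ge0 (exprn_ge0 _ z0); apply: mulr_ge0 c0; exact/rising_binomial_ge0/ltW.
have b0 : 0 < beta / a by rewrite divr_gt0.
(* The term k = 0 equals c, the mass of the atom, and is split off. Used at r = 1 for the
   summability of the weights and at r = [q u] for the transform of the density. *)
have cvg_tail r : 0 <= r <= 1 -> series (fun i => p i.+1 * r ^+ i.+1) @ \oo -->
    c * (1 - (1 - a ^+ 2) * r) `^ (- alpha) - c.
  move=> r01; have := cvg_rising_binomialM alpha_gt0 a01 r01.
  rewrite -cvg_shiftS => L.
  rewrite (_ : series _ = (fun n => \sum_(0 <= k < n.+1) p k * r ^+ k - c)).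
    by apply: cvgB; [exact: L|exact: cvg_cst].
  apply/funext => n; rewrite /series/= big_nat_recl//= /p rising_binomial0 !expr0 !mulr1 mul1r.
  by rewrite [c + _]addrC addrK.
have cvg_p : cvgn (series (fun i => p i.+1)).
  have := @cvg_tail 1; rewrite ler01 lexx => /(_ isT) /cvgP.
  by under eq_fun do rewrite expr1n mulr1.
pose g := fbar_mixture (fun i => p i.+1) (beta / a).
have g_ge0 : forall x, 0 <= g x := fbar_mixture_ge0 (fun i => p_ge0 i.+1) cvg_p b0.
have ig := integrable_fbar_mixture (fun i => p_ge0 i.+1) cvg_p b0.
exists g.
  move=> x _; rewrite -cvg_shiftS.
  under eq_fun do rewrite big_add1/=.
  exact: (cvg_fbar_mixture (fun i => p_ge0 i.+1) cvg_p b0).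
split => //; first exact: (measurable_fbar_mixture (fun i => p_ge0 i.+1) cvg_p b0).
move=> A mA; rewrite -(atom_densityE c0 g_ge0 ig).
(* The candidate enters as a finite measure; its total mass 1 results from this equality with P. *)
apply: charfun_unique => // u; rewrite P_charfun.
have Ec : (\int[@lebesgue_measure R]_x (cos (u * x) * g x))%R = s u - c.
  have bE : (beta / a) ^+ 2 / ((beta / a) ^+ 2 + u ^+ 2) = q u.
    rewrite /q; field; rewrite gt_eqF ?gt_eqF//.
    by rewrite ltr_wpDr ?sqr_ge0// exprn_gt0.
  have L := Rintegral_fbar_mixture (fun i => p_ge0 i.+1) cvg_p b0 (measurable_cosM u)
    (fun x => norm_cos_le1 _) (fun i => fbar_cos i u b0).
  rewrite bE in L.
  exact: (cvg_unique _ L (cvg_tail _ (q01 u))).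
have Es : (\int[@lebesgue_measure R]_x (sin (u * x) * g x))%R = 0.
  have L := Rintegral_fbar_mixture (fun i => p_ge0 i.+1) cvg_p b0 (measurable_sinM u)
    (fun x => norm_sin_le1 _) (fun i => fbar_sin i u b0).
  have E : series (fun i => p i.+1 * 0) = (fun=> 0).
    by apply/funext => n; rewrite /series/= big1// => i _; rewrite mulr0.
  rewrite E in L.
  exact: (cvg_unique _ L (cvg_cst _)).
have [Fc Fs] := (Rintegral_atom_density c0 g_ge0 ig (measurable_cosM u) (fun x => norm_cos_le1 _),
  Rintegral_atom_density c0 g_ge0 ig (measurable_sinM u) (fun x => norm_sin_le1 _)).
rewrite /charfun -[fine (\int[_]_x (cos _)%:E)]/(Rintegral _ _ _) -[fine (\int[_]_x (sin _)%:E)]/(Rintegral _ _ _) Fc Fs Ec Es mulr0 cos0 sin0 mulr1 mulr0 addr0 addrC subrK.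
by [].
Qed.
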